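(* (i) Let $A\in\mathbb{Z}^{d\times n}$ be a normal matrix of rank $d$. If $d=1$ or $d=2$, or if $A$ is graded and $d=3$, then every regular triangulation of $\mathrm{cone}(A)$ supports at least one Gomory family. (ii) Let $A\in\mathbb{Z}^{d\times n}$ be a normal matrix of rank $d$. If $d=2$ and $A$ is graded, then every regular triangulation of $\mathrm{cone}(A)$ supports exactly one Gomory family. (iii) If $d=3$ and $A$ is not graded, or if $d=4$ and $A$ is graded, then not all regular triangulations of $\mathrm{cone}(A)$ need support a Gomory family: there exist a non-graded normal matrix $A$ of rank $d=3$, and a graded normal matrix $A$ of rank $d=4$, each having a regular triangulation of $\mathrm{cone}(A)$ that supports no Gomory family. In particular, in each of these two cases there is such an $A$ that is not $\Delta$-normal with respect to every regular triangulation $\Delta$ of $\mathrm{cone}(A)$.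
   Context: $\mathbb{N}$ denotes the non-negative integers. All matrices $A \in \mathbb{Z}^{d\times n}$ considered have rank $d$, with columns $a_1,\dots,a_n$; $\mathrm{cone}(A)=\{Au : u\in\mathbb{R}^n, u\ge 0\}$ is pointed and $\{u\in\mathbb{R}^n: Au=0, u\ge 0\}=\{0\}$; $\mathbb{N}A=\{Au: u\in\mathbb{N}^n\}$. $A$ is normal if $\mathbb{N}A=\mathrm{cone}(A)\cap\mathbb{Z}^d$, and the columns of $A$ are assumed to form the unique minimal Hilbert basis of $\mathrm{cone}(A)$ (in particular they are distinct). $A$ is graded if its columns span an affine hyperplane in $\mathbb{R}^d$. For $b\in\mathbb{N}A$ and a cost vector $c\in\mathbb{Z}^n$, $IP_{A,c}(b)$ is the program $\min\{c\cdot x: Ax=b, x\in\mathbb{N}^n\}$; $IP_{A,c}$ is the family of these programs. $c$ is generic if each $IP_{A,c}(b)$, $b\in\mathbb{N}A$, has a unique optimal solution. $\mathcal{O}_c\subset\mathbb{N}^n$ is the set of all optimal solutions of all programs in $IP_{A,c}$. For $\sigma\subseteq\{1,\dots,n\}$, $\bar\sigma$ is the complement, $A_\sigma$ the submatrix of columns indexed by $\sigma$, $x_\sigma$ the subvector indexed by $\sigma$. For generic $c$, $\Delta_c$ is the set of all $\sigma\subseteq\{1,\dots,n\}$ for which there is $y\in\mathbb{R}^d$ with $y\cdot a_j=c_j$ for $j\in\sigma$ and $y\cdot a_j<c_j$ for $j\notin\sigma$; its elements are called faces, and the cones $\mathrm{cone}(A_\sigma)$, $\sigma\in\Delta_c$,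 form a triangulation of $\mathrm{cone}(A)$ (a complex of simplicial cones with support $\mathrm{cone}(A)$, whose maximal faces have $d$ elements). A regular triangulation of $\mathrm{cone}(A)$ is one of the form $\Delta_c$ for a generic cost vector $c$. Group relaxation: for a maximal face $\sigma$ of $\Delta_c$ and $b\in\mathbb{N}A$, $G^\sigma(b)$ is the program $\min\{(c_{\bar\sigma}-c_\sigma A_\sigma^{-1}A_{\bar\sigma})\cdot x_{\bar\sigma}: A_\sigma x_\sigma+A_{\bar\sigma}x_{\bar\sigma}=b,\ x_{\bar\sigma}\ge 0,\ (x_\sigma,x_{\bar\sigma})\in\mathbb{Z}^n\}$; it solves $IP_{A,c}(b)$ if its (unique) optimal solution is non-negative. $IP_{A,c}$ is a Gomory family if for every $b\in\mathbb{N}A$, $IP_{A,c}(b)$ is solved by $G^\sigma(b)$ for some maximal face $\sigma$ of $\Delta_c$. A regular triangulation $\Delta$ supports a Gomory family $IP_{A,c}$ if $c$ is generic, $\Delta=\Delta_c$ and $IP_{A,c}$ is a Gomory family. Two families $IP_{A,c}$ and $IP_{A,\omega}$ are counted as the same if $\mathcal{O}_c=\mathcal{O}_\omega$. $A$ is $\Delta$-normal for a triangulation $\Delta$ of $\mathrm{cone}(A)$ if for every maximal face $\sigma\in\Delta$, the columns of $A$ lying in $\mathrm{cone}(A_\sigma)$ form a Hilbert basis of $\mathrm{cone}(A_\sigma)$, i.e. every point of $\mathrm{cone}(A_\sigma)\cap\mathbb{Z}^d$ is a non-negative integer combination of these columns. *)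

(* Defs.v *)
From HB Require Import structures.
From mathcomp Require Import all_boot all_order all_algebra.
From mathcomp Require Import boolp classical_sets reals.

Set Implicit Arguments.
Unset Strict Implicit.
Unset Printing Implicit Defensive.

Import Order.TTheory GRing.Theory Num.Theory.
Local Open Scope ring_scope.

(* Vectors of N^n are integer column vectors satisfying [nonneg]. *)
Definition nonneg (K : numDomainType) (n : nat) (u : 'cV[K]_n) : Prop :=
  forall j, 0 <= u j 0.

Definition cols (d n : nat) (A : 'M[int]_(d, n)) : seq 'cV[int]_d :=
  [seq col j A | j <- enum 'I_n].

(* M_sigma, the columns being listed in increasing order of their index. *)
Definition csub (K : Type) (m n : nat) (s : {set 'I_n}) (M : 'M[K]_(m, n)) :
  'M[K]_(m, #|s|) := colsub (@enum_val _ (mem s)) M.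

Definition rsub (K : Type) (m n : nat) (s : {set 'I_n}) (M : 'M[K]_(n, m)) :
  'M[K]_(#|s|, m) := rowsub (@enum_val _ (mem s)) M.

Section Cones.
Variable R : realType.

Definition cone (d n : nat) (A : 'M[int]_(d, n)) : set 'cV[R]_d :=
  fun v => exists u : 'cV[R]_n, nonneg u /\ v = map_mx intr A *m u.

Definition pointed (d : nat) (K : set 'cV[R]_d) : Prop :=
  forall v, K v -> K (- v) -> v = 0.

Definition hilbert_basis (d : nat) (H : seq 'cV[int]_d) (K : set 'cV[R]_d) :
    Prop :=
  (forall h, h \in H -> K (map_mx intr h)) /\
  (forall b : 'cV[int]_d, K (map_mx intr b) ->
     exists k : 'cV[int]_d -> nat, b = \sum_(h <- H) h *+ k h).

(* Minimality is with respect to inclusion; for a pointed rational cone a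
   minimal Hilbert basis is unique. *)
Definition minimal_hilbert_basis (d : nat) (H : seq 'cV[int]_d)
    (K : set 'cV[R]_d) : Prop :=
  hilbert_basis H K /\
  (forall H' : seq 'cV[int]_d,
     hilbert_basis H' K -> {subset H' <= H} -> {subset H <= H'}).

Definition affine_hull (d n : nat) (A : 'M[int]_(d, n)) : set 'cV[R]_d :=
  fun v => exists l : 'cV[R]_n, \sum_j l j 0 = 1 /\ v = map_mx intr A *m l.

End Cones.

Section Matrices.
Variables d n : nat.
Implicit Types (A : 'M[int]_(d, n)) (c : 'rV[int]_n) (b : 'cV[int]_d)
  (x : 'cV[int]_n) (s : {set 'I_n}) (Delta : set {set 'I_n}).

Definition in_NA A b : Prop := exists x, nonneg x /\ b = A *m x.

Definition cost c x : int := (c *m x) 0 0.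

Definition feasible A b x : Prop := A *m x = b /\ nonneg x.

Definition optimal A c b x : Prop :=
  feasible A b x /\ forall x', feasible A b x' -> cost c x <= cost c x'.

Definition generic A c : Prop :=
  forall b, in_NA A b -> exists! x, optimal A c b x.

Definition opt_solutions A c : set 'cV[int]_n :=
  fun x => exists b, in_NA A b /\ optimal A c b x.

Definition maximal_face Delta s : Prop :=
  Delta s /\ forall t, Delta t -> s \subset t -> t = s.

Section Real.
Variable R : realType.

Definition normal A : Prop :=
  forall b, in_NA A b <-> cone A (map_mx intr b : 'cV[R]_d).

Definition admissible A : Prop :=
  [/\ \rank (map_mx intr A : 'M[R]_(d, n)) = d,
      pointed (@cone R d n A),
      (forall u : 'cV[R]_n, nonneg u -> map_mx intr A *m u = 0 -> u = 0),
      uniq (cols A)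
    & minimal_hilbert_basis (cols A) (@cone R d n A)].

Definition graded A : Prop :=
  exists (w : 'rV[R]_d) (beta : R), w != 0 /\
    forall v : 'cV[R]_d, affine_hull A v <-> (w *m v) 0 0 = beta.

Definition faces A c : set {set 'I_n} :=
  fun s => exists y : 'rV[R]_d,
    (forall j, j \in s -> (y *m map_mx intr (col j A)) 0 0 = (c 0 j)%:~R) /\
    (forall j, j \notin s -> (y *m map_mx intr (col j A)) 0 0 < (c 0 j)%:~R).

Definition regular_triangulation A Delta : Prop :=
  exists c, generic A c /\ Delta = faces A c.

(* When s is a maximal face, the d x #|s| matrix A_s is square and invertible,
   and its partial inverse pinvmx is the (two-sided) inverse A_s^-1. *)
Definition reduced_cost A c s : 'rV[R]_#|~: s| :=
  let A' : 'M[R]_(d, n) := map_mx intr A in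
  let c' : 'rV[R]_n := map_mx intr c in
  csub (~: s) c' - csub s c' *m pinvmx (csub s A') *m csub (~: s) A'.

Definition group_cost A c s x : R :=
  (reduced_cost A c s *m map_mx intr (rsub (~: s) x)) 0 0.

Definition group_feasible A s b x : Prop :=
  csub s A *m rsub s x + csub (~: s) A *m rsub (~: s) x = b /\
  nonneg (rsub (~: s) x).

Definition group_optimal A c s b x : Prop :=
  group_feasible A s b x /\
  forall x', group_feasible A s b x' -> group_cost A c s x <= group_cost A c s x'.

Definition group_solves A c s b : Prop :=
  exists x, unique (group_optimal A c s b) x /\ nonneg x.

Definition gomory_family A c : Prop :=
  forall b, in_NA A b ->
    exists s, maximal_face (faces A c) s /\ group_solves A c s b.

Definition supports A Delta c : Prop :=
  [/\ generic A c, Delta = faces A c & gomory_family A c].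

Definition Delta_normal A Delta : Prop :=
  forall s, maximal_face Delta s ->
    let K : set 'cV[R]_d := cone (csub s A) in
    hilbert_basis [seq a <- cols A | `[< K (map_mx intr a) >]] K.

End Real.
End Matrices.

(* Main.v *)
Require Import Defs.
From HB Require Import structures.
From mathcomp Require Import all_boot all_order all_algebra.
From mathcomp Require Import boolp classical_sets reals.
From mathcomp Require Import ring lra zify.

(** A maximal face of the triangulation of a generic cost vector [c] is a basis
of columns, and the cones of the maximal faces cover [cone A].  Both facts come
from the dual polyhedron of the linear relaxations: by genericity its faces are
simplicial ([generic_indep], [maximal_face_basis]), and the dual simplex method
leads from any of its vertices to one whose cell contains a given point
([cone_cover]).  The group relaxation at a cell [s] then minimises the cost over
integer solutions that may be negative on [s] only ([group_optimalE]).

Existence.  Suppose that the lattice points of every cell are generated by the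
columns in it.  Keep the costs of the vertices of the triangulation, and give
every other column a cost that exceeds the piecewise linear interpolation by a
small multiple of the sum of its coordinates in its cell.  For a right-hand side
[b] in the cell [s], a group solution with all its columns in the cone of [s]
takes away from the coordinates of [b] a non-negative vector that is congruent
to them modulo 1.  The cost penalises the coordinate sum of this vector, so it
is minimal exactly when this vector is the fractional part, and then the basic
variables are the integer parts, which are non-negative.  Columns outside the
cone are too expensive to be used, and ties are broken by a perturbation in a
large base.  This is [gomory_group_optimum], which gives
[supports_of_cell_normal].

In low dimension every cell satisfies the hypothesis.  By subdivision it
suffices to find, for each basis whose half-open parallelepiped contains a
non-zero lattice point [b], a further column in the cone
([cell_normal_of_parallelepiped]).  In dimension 2 this follows from the
irreducibility of the two basis vectors; in the graded case of dimension 3, from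
heights: either [b] or its reflection in the centre of the parallelepiped has
height 1, hence is a column.

Uniqueness, in the graded planar case.  A column [t] that is not a vertex is the
only solution of its own program, so in a Gomory family it is optimal for the
group relaxation at some cell.  Modulo that cell it is congruent to one column
inside the cell, and sending [t] to this column is an injective map along which
the excess of the cost over the lower envelope does not decrease.  Summing the
excess over all [t] shows that it is constant along the map, and then uniqueness
of the group optimum shows that [t] itself lies in the cell
([non_vertex_own_cell]).  This determines the optimal solution of every program
from the triangulation.

Failure.  Suppose that the columns satisfy [u + w = 2v] and
[v + w + p = u + Q], where [Q] stands for the sum of one or two columns, that
[u], [v] and [Q] form a cell, and that [w + p] has no other representation.  At
each cell, which contains [u] or [v], one of [w + p = u + Q - v] and
[w + p = 2v - u + p] gives a cheaper group solution, so the program of [w + p]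
is not solved by any group relaxation ([no_gomory_family]).  With one column in
[Q] this occurs for a matrix of rank 3 that is not graded, with two for a graded
one of rank 4. *)

Set Implicit Arguments.
Unset Strict Implicit.
Unset Printing Implicit Defensive.

Import Order.TTheory GRing.Theory Num.Theory.
Local Open Scope ring_scope.

(** * Gordan's alternative *)

Section EntriesOfProducts.
Variables (K : comPzRingType) (m n p : nat).
Implicit Types (B : 'M[K]_(m, n)) (C : 'M[K]_(n, p)).

Lemma mulmxDlE B1 B2 C i j :
  ((B1 + B2) *m C) i j = (B1 *m C) i j + (B2 *m C) i j.
Proof. by rewrite mulmxDl mxE. Qed.

Lemma mulmxNlE B C i j : (- B *m C) i j = - (B *m C) i j.
Proof. by rewrite mulNmx mxE. Qed.

Lemma mulmxZlE a B C i j : ((a *: B) *m C) i j = a * (B *m C) i j.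
Proof. by rewrite -scalemxAl mxE. Qed.

Lemma mulmxDrE B C1 C2 i j :
  (B *m (C1 + C2)) i j = (B *m C1) i j + (B *m C2) i j.
Proof. by rewrite mulmxDr mxE. Qed.

Lemma mulmxNrE B C i j : (B *m - C) i j = - (B *m C) i j.
Proof. by rewrite mulmxN mxE. Qed.

Lemma mulmxZrE a B C i j : (B *m (a *: C)) i j = a * (B *m C) i j.
Proof. by rewrite -scalemxAr mxE. Qed.

Definition mulmx_linE :=
  (mulmxDlE, mulmxNlE, mulmxZlE, mulmxDrE, mulmxNrE, mulmxZrE).

End EntriesOfProducts.

Lemma mulmx_sum_cols (K : comPzRingType) (m n : nat) (M : 'M[K]_(m, n))
    (x : 'cV[K]_n) :
  M *m x = \sum_j x j 0 *: col j M.
Proof.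
apply/matrixP => i k; rewrite ord1 mxE summxE.
by apply: eq_bigr => j _; rewrite !mxE mulrC.
Qed.

Lemma self_dot_gt0 (F : realFieldType) (d : nat) (v : 'cV[F]_d) :
  v != 0 -> 0 < (v^T *m v) 0 0.
Proof.
move=> v0; rewrite mxE.
have ge0 (k : 'I_d) : true -> 0 <= v^T 0 k * v k 0.
  by move=> _; rewrite mxE -expr2 sqr_ge0.
rewrite lt0r sumr_ge0 // andbT; apply: contra v0 => /eqP e0.
apply/eqP/matrixP => k j; rewrite ord1 mxE.
have /eqP := psumr_eq0P ge0 e0 (isT : xpredT k).
by rewrite !mxE -expr2 sqrf_eq0 => /eqP.
Qed.

Lemma small_enough (F : realFieldType) (I : finType) (a g : I -> F) :
  (forall i, a i < 0) -> exists2 e, 0 < e & forall i, a i + e * g i < 0.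
Proof.
move=> a0; pose B := 1 + \sum_i `|g i| / - a i.
have t0 i : 0 <= `|g i| / - a i by rewrite divr_ge0 // oppr_ge0 ltW.
have B0 : 0 < B by rewrite ltr_pwDl // sumr_ge0.
exists B^-1 => [|i]; first by rewrite invr_gt0.
have gB : `|g i| / - a i < B.
  rewrite /B (bigD1 i) //= addrCA ltr_pwDr //.
  by rewrite ltr_pwDl // sumr_ge0.
rewrite ltr_pdivrMr ?oppr_gt0 // in gB.
rewrite -ltrBrDl sub0r [_^-1 * _]mulrC ltr_pdivrMr // mulrC.
exact: le_lt_trans (ler_norm _) gB.
Qed.

(** Induction on the number of vectors.  If a functional [y] that is negative on
the other vectors fails at the last vector [w], the others are pushed along [w]
into the kernel of [y].  A relation between the pushed vectors is one between
the original vectors and [w]; a functional that is negative on the pushed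
vectors can be corrected to vanish at [w], and then tilted by a small multiple
of [w] itself. *)
Lemma gordan (F : realFieldType) (d n : nat) (v : 'I_n -> 'cV[F]_d) :
  (exists y : 'rV_d, forall i, (y *m v i) 0 0 < 0) \/
  (exists u : 'I_n -> F, [/\ forall i, 0 <= u i, exists i, 0 < u i &
                             \sum_i u i *: v i = 0]).
Proof.
elim: n v => [|n IHn] v; first by left; exists 0; case.
pose w := v ord_max; pose v1 i := v (widen_ord (leqnSn n) i).
have split_ord (P : 'I_n.+1 -> Prop) :
    (forall i, P (widen_ord (leqnSn n) i)) -> P ord_max -> forall i, P i.
  move=> Pw Pm i; case: (ltnP i n) => [lt_i_n | le_n_i].
    by have -> : i = widen_ord (leqnSn n) (Ordinal lt_i_n) by apply: val_inj.
  by have -> : i = ord_max by apply: val_inj; apply/eqP; rewrite eqn_leq -ltnS ltn_ord.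
pose ext (u : 'I_n -> F) (t : F) (i : 'I_n.+1) := oapp u t (insub (val i)).
have extw u t i : ext u t (widen_ord (leqnSn n) i) = u i.
  by rewrite /ext /= valK.
have extm u t : ext u t ord_max = t by rewrite /ext /= insubF // ltnn.
have rel (u : 'I_n -> F) t : (forall i, 0 <= u i) -> 0 <= t ->
    (exists i, 0 < u i) \/ 0 < t -> \sum_i u i *: v1 i + t *: w = 0 ->
    exists u : 'I_n.+1 -> F, [/\ forall i, 0 <= u i, exists i, 0 < u i &
                             \sum_i u i *: v i = 0].
  move=> u0 t0 ut e0; exists (ext u t); split.
  - by apply: split_ord => [i|]; rewrite ?extw ?extm.
  - case: ut => [[i ui]|tp]; first by exists (widen_ord (leqnSn n) i); rewrite extw.
    by exists ord_max; rewrite extm.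
  - rewrite big_ord_recr /= extm -/w -[RHS]e0; congr (_ + _).
    by apply: eq_bigr => i _; rewrite extw.
have [[y yv]|[u [u0 [i ui] e0]]] := IHn v1; last first.
  by right; apply: (rel u 0); rewrite ?scale0r ?addr0 //; left; exists i.
set al := (y *m w) 0 0.
have [al0|al0] := ltP al 0; first by left; exists y; apply: split_ord.
have [w0|w0] := eqVneq w 0.
  right; apply: (rel (fun=> 0) 1) => //; first by right.
  by rewrite w0 scaler0 addr0 big1 // => i _; rewrite scale0r.
have [[z zv]|[u [u0 [i ui] e0]]] :=
    IHn (fun i => al *: v1 i - (y *m v1 i) 0 0 *: w); last first.
  right; apply: (rel (fun i => al * u i) (\sum_i u i * - (y *m v1 i) 0 0)).
  - by move=> k; rewrite mulr_ge0.
  - by rewrite sumr_ge0 // => k _; rewrite mulr_ge0 // oppr_ge0 ltW.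
  - right; rewrite (bigD1 i) //= ltr_pwDl ?mulr_gt0 ?oppr_gt0 //.
    by rewrite sumr_ge0 // => k _; rewrite mulr_ge0 // oppr_ge0 ltW.
  - rewrite -[RHS]e0 scaler_suml -big_split; apply: eq_bigr => k _ /=.
    by rewrite scalerBr !scalerA mulrN scaleNr [al * _]mulrC.
left; pose be := (z *m w) 0 0.
pose x0 := al *: z - be *: y.
have x0w : (x0 *m w) 0 0 = 0.
  by rewrite !mulmx_linE -/al -/be mulrC subrr.
have x0v i : (x0 *m v1 i) 0 0 < 0.
  by have := zv i; rewrite !mulmx_linE -/be [be * _]mulrC.
clearbody x0.
have [e e0 ev] := small_enough (fun i => - (w^T *m v1 i) 0 0) x0v.
exists (x0 - e *: w^T); apply: split_ord => [i|].
  by have := ev i; rewrite !mulmx_linE mulrN.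
rewrite !mulmx_linE x0w sub0r oppr_lt0.
by rewrite mulr_gt0 // self_dot_gt0.
Qed.

(** * The dual polyhedron and independence of faces *)

Lemma common_denominator (I : finType) (f : I -> rat) :
  exists2 D : nat, (0 < D)%N &
    forall i, exists z : int, z%:~R = D%:R * f i.
Proof.
exists (\prod_i `|denq (f i)|)%N => [|i].
  by rewrite prodn_gt0 // => i; rewrite absz_gt0 denq_neq0.
rewrite (bigD1 i) //=; set r := (\prod_(_ | _) _)%N.
exists (r%:Z * numq (f i)); rewrite mulnC natrM -mulrA [_%:R * f i]mulrC.
by rewrite natr_absz normr_denq -numqE intrM.
Qed.

Definition supported (K : nmodType) (n : nat) (s : {set 'I_n}) (x : 'cV[K]_n) :=
  forall j, j \notin s -> x j 0 = 0.

Lemma csub_mul (K : pzRingType) (m n : nat) (s : {set 'I_n}) (M : 'M[K]_(m, n)) :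
  csub s M = M *m csub s 1%:M.
Proof.
apply/matrixP => i j; rewrite !mxE (bigD1 (enum_val j)) //= !mxE eqxx mulr1.
rewrite big1 ?addr0 // => k kj; rewrite !mxE.
by rewrite (negPf kj) mulr0.
Qed.

Lemma supported_csub (K : pzRingType) (n : nat) (s : {set 'I_n}) (z : 'cV[K]_#|s|) :
  supported s (csub s 1%:M *m z).
Proof.
move=> j js; rewrite mxE big1 // => k _; rewrite !mxE.
by case: eqP => [e|_]; rewrite ?mul0r //; rewrite e enum_valP in js.
Qed.

Lemma csub_rsub (K : pzRingType) (n : nat) (s : {set 'I_n}) (x : 'cV[K]_n) :
  supported s x -> csub s 1%:M *m rsub s x = x.
Proof.
move=> xs; apply/matrixP => j k; rewrite ord1 {k}.
have [js|js] := boolP (j \in s); last by rewrite supported_csub ?xs.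
rewrite mxE (bigD1 (enum_rank_in js j)) //= !mxE enum_rankK_in // eqxx mul1r.
rewrite big1 ?addr0 // => k kj; rewrite !mxE; case: eqP => [e|_]; last by rewrite mul0r.
by case/eqP: kj; apply: enum_val_inj; rewrite enum_rankK_in.
Qed.

Lemma csub_inj (K : pzRingType) (n : nat) (s : {set 'I_n}) (z : 'cV[K]_#|s|) :
  csub s 1%:M *m z = 0 -> z = 0.
Proof.
move=> e; apply/matrixP => k i; rewrite ord1 mxE.
have /matrixP/(_ (enum_val k) 0) := e; rewrite !mxE (bigD1 k) //= !mxE eqxx mul1r.
rewrite big1 ?addr0 // => l lk; rewrite !mxE.
by rewrite (inj_eq enum_val_inj) eq_sym (negPf lk) mul0r.
Qed.

Section Faces.
Variables (R : realType) (d n : nat) (A : 'M[int]_(d, n)).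
Implicit Types (c : 'rV[int]_n) (s : {set 'I_n}) (y : 'rV[R]_d).
Local Notation toR := (map_mx (intr : int -> R)).
Local Notation AR := (toR A).

Definition dual c y := forall j, (y *m AR) 0 j <= (c 0 j)%:~R.

Definition tight c y : {set 'I_n} :=
  [set j | (y *m AR) 0 j == (c 0 j)%:~R].

Definition indep s := forall x : 'cV[R]_n, supported s x -> AR *m x = 0 -> x = 0.

Lemma dot_colE y j : (y *m toR (col j A)) 0 0 = (y *m AR) 0 j.
Proof. by rewrite !mxE; apply: eq_bigr => k _; rewrite !mxE. Qed.

(** A face is the set of constraints that are tight at some point of the dual
polyhedron of the linear relaxations. *)
Lemma facesP c s : faces R A c s <-> exists2 y, dual c y & s = tight c y.
Proof.
split=> [[y [y_eq y_lt]]|[y yc ->]].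
  exists y => [j|].
    have [js|js] := boolP (j \in s); rewrite -dot_colE; first by rewrite y_eq.
    by rewrite ltW // y_lt.
  apply/setP => j; rewrite inE -dot_colE.
  have [js|js] := boolP (j \in s); first by rewrite y_eq // eqxx.
  by rewrite lt_eqF // y_lt.
exists y; split=> j; rewrite inE dot_colE; first by move/eqP.
by rewrite lt_neqAle yc andbT.
Qed.

Lemma costE c (x : 'cV[int]_n) : (cost c x)%:~R = (toR c *m toR x) 0 0.
Proof. by rewrite -map_mxM mxE. Qed.

Lemma gapE c y (x : 'cV[R]_n) :
  (toR c *m x) 0 0 - (y *m (AR *m x)) 0 0 =
  \sum_j ((c 0 j)%:~R - (y *m AR) 0 j) * x j 0.
Proof.
rewrite mulmxA mxE [X in _ - X]mxE -sumrB; apply: eq_bigr => j _.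
by rewrite mulrBl [toR c 0 j]mxE.
Qed.

Lemma weak_duality c y (x : 'cV[R]_n) :
  dual c y -> (forall j, j \notin tight c y -> 0 <= x j 0) ->
  (y *m (AR *m x)) 0 0 <= (toR c *m x) 0 0.
Proof.
move=> yc x0; rewrite -subr_ge0 gapE sumr_ge0 // => j _.
have [|/x0 xj] := boolP (j \in tight c y); last by rewrite mulr_ge0 // subr_ge0.
by rewrite inE => /eqP->; rewrite subrr mul0r.
Qed.

Lemma tight_duality c y (x : 'cV[R]_n) :
  supported (tight c y) x -> (y *m (AR *m x)) 0 0 = (toR c *m x) 0 0.
Proof.
move=> xs; apply/eqP; rewrite eq_sym -subr_eq0 gapE big1 // => j _.
have [|/xs->] := boolP (j \in tight c y); last by rewrite mulr0.
by rewrite inE => /eqP->; rewrite subrr mul0r.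
Qed.

Lemma complementary_slackness c y (x : 'cV[R]_n) :
  dual c y -> nonneg x -> (toR c *m x) 0 0 <= (y *m (AR *m x)) 0 0 ->
  supported (tight c y) x.
Proof.
move=> yc x0; rewrite -subr_le0 gapE => le0 j; rewrite inE => yj.
have t0 k : true -> 0 <= ((c 0 k)%:~R - (y *m AR) 0 k) * x k 0.
  by move=> _; rewrite mulr_ge0 ?subr_ge0.
have /eqP e : \sum_j ((c 0 j)%:~R - (y *m AR) 0 j) * x j 0 == 0.
  by rewrite eq_le le0 sumr_ge0.
have /(_ j)/eqP := psumr_eq0P t0 e (isT : xpredT j).
by rewrite mulf_eq0 subr_eq0 eq_sym (negPf yj) => /eqP.
Qed.

(** The rank does not change between the rationals and the reals, so a real linear
dependence yields a rational one, and denominators can be cleared. *)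
Lemma int_kernel (k : nat) (B : 'M[int]_(d, k)) :
  \rank (toR B) != k -> exists2 z : 'cV[int]_k, z != 0 & B *m z = 0.
Proof.
pose BQ : 'M[rat]_(d, k) := map_mx intr B.
have -> : toR B = map_mx (ratr : rat -> R) BQ.
  by apply/matrixP => i j; rewrite !mxE ratr_int.
rewrite mxrank_map => rk.
have : ~~ row_free BQ^T by rewrite /row_free mxrank_tr.
rewrite -kermx_eq0 => /rowV0Pn [v /sub_kermxP vB v0].
have [D D0 fz] := common_denominator (fun j => v 0 j).
pose z : 'cV[int]_k := \col_j sval (cid (fz j)).
have zE j : (z j 0)%:~R = D%:R * v 0 j by rewrite mxE (svalP (cid (fz j))).
exists z.
  apply: contra v0 => /eqP z0; apply/eqP/matrixP => i j; rewrite ord1 mxE.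
  have := zE j; rewrite z0 mxE => /esym/eqP; rewrite mulf_eq0 pnatr_eq0.
  by rewrite -[D == 0%N]negbK -lt0n D0 => /eqP.
have : map_mx intr (B *m z) = 0 :> 'cV[rat]_d.
  rewrite map_mxM /= -/BQ.
  have -> : map_mx intr z = D%:R *: v^T :> 'cV[rat]_k.
    by apply/matrixP => j i; rewrite ord1 [LHS]mxE zE !mxE.
  by rewrite -scalemxAr -[BQ]trmxK -trmx_mul vB trmx0 scaler0.
move=> /matrixP e; apply/matrixP => i j; have := e i j; rewrite !mxE.
by move=> /eqP; rewrite intr_eq0 => /eqP.
Qed.

Lemma indep_rank s : indep s -> \rank (csub s AR) = #|s|.
Proof.
move=> si; rewrite -mxrank_tr; apply/eqP; rewrite -/(row_free _) -kermx_eq0.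
apply/rowV0P => v /sub_kermxP vB.
have e : csub s AR *m v^T = 0 by rewrite -[csub s AR]trmxK -trmx_mul vB trmx0.
rewrite csub_mul -mulmxA in e.
by have /csub_inj/eqP := si _ (supported_csub _) e; rewrite trmx_eq0 => /eqP.
Qed.

Lemma rank_indep s : \rank (csub s AR) = #|s| -> indep s.
Proof.
move=> rk x xs; rewrite -(csub_rsub xs) mulmxA -csub_mul => e.
have : row_free (csub s AR)^T by rewrite /row_free mxrank_tr rk.
move=> /row_free_inj inj; have /eqP : (rsub s x)^T = 0.
  by apply: inj; rewrite mul0mx -trmx_mul e trmx0.
by rewrite trmx_eq0 => /eqP ->; rewrite mulmx0.
Qed.

(** An integer relation supported on a face splits into two non-negative
parts, which are optimal solutions of one and the same program. *)
Lemma generic_indep c s : generic A c -> faces R A c s -> indep s.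
Proof.
move=> cgen /facesP[y yc ys]; apply: rank_indep; apply/eqP; apply: contraT => rk.
have [z z0 Bz] : exists2 z : 'cV[int]_#|s|, z != 0 & csub s A *m z = 0.
  apply: int_kernel; apply: contra rk => /eqP e; apply/eqP; rewrite -[RHS]e.
  by congr (\rank _); apply/matrixP => i j; rewrite !mxE.
pose x := csub s 1%:M *m z.
have xs : supported s x by apply: supported_csub.
have Ax : A *m x = 0 by rewrite /x mulmxA -csub_mul.
pose xp : 'cV[int]_n := \col_j Num.max (x j 0) 0.
pose xm : 'cV[int]_n := \col_j Num.max (- x j 0) 0.
have xE : x = xp - xm by apply/matrixP => j i; rewrite ord1 !mxE; lia.
have opt (x' : 'cV[int]_n) : nonneg x' -> supported s x' -> optimal A c (A *m x') x'.
  move=> x0 x's; split=> // x2 [Ax2 x20].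
  rewrite -(ler_int R) !costE -(@tight_duality c y).
    rewrite -map_mxM -Ax2 map_mxM; apply: weak_duality => // j _.
    by rewrite mxE ler0z.
  by move=> j js; rewrite mxE x's ?mulr0z // ys.
have xp0 : nonneg xp by move=> j; rewrite mxE; lia.
have xm0 : nonneg xm by move=> j; rewrite mxE; lia.
have op : optimal A c (A *m xp) xp by apply: opt => // j /xs xj; rewrite [xp j 0]mxE xj.
have om : optimal A c (A *m xp) xm.
  have -> : A *m xp = A *m xm.
    by apply/eqP; rewrite -subr_eq0 -mulmxBr -xE Ax.
  by apply: opt => // j /xs xj; rewrite [xm j 0]mxE xj oppr0.
have [w [_ wu]] := cgen (A *m xp) (ex_intro _ xp (conj xp0 erefl)).
have /csub_inj/eqP : x = 0 by rewrite xE -(wu _ op) (wu _ om) subrr.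
by rewrite (negPf z0).
Qed.

End Faces.

(** * Maximal faces as simplicial cells *)

Section Triangulation.
Variables (R : realType) (d n : nat) (A : 'M[int]_(d, n)).
Implicit Types (c : 'rV[int]_n) (s : {set 'I_n}) (y w : 'rV[R]_d).
Local Notation toR := (map_mx (intr : int -> R)).
Local Notation AR := (toR A).

(** The ray from [y] in direction [w] stops at the first constraint that becomes
tight. *)
Lemma ratio_test c y w :
  dual A c y -> (exists k, 0 < (w *m AR) 0 k) ->
  exists t k, [/\ 0 <= t, dual A c (y + t *: w), 0 < (w *m AR) 0 k &
                  k \in tight A c (y + t *: w)].
Proof.
move=> yc [k0 wk0].
pose rho k := ((c 0 k)%:~R - (y *m AR) 0 k) / (w *m AR) 0 k.
have [k wk kmin] := @arg_minP _ R 'I_n k0 (fun k => 0 < (w *m AR) 0 k) rho wk0.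
exists (rho k), k.
have rho0 j : 0 < (w *m AR) 0 j -> 0 <= rho j.
  by move=> wj; rewrite divr_ge0 ?subr_ge0 ?yc // ltW.
split=> //; first exact: rho0.
  move=> j; rewrite !mulmx_linE; have [wj|wj] := ltP 0 ((w *m AR) 0 j).
    by rewrite -lerBrDl -ler_pdivlMr // kmin.
  by rewrite -[leRHS]addr0 lerD ?yc // mulr_ge0_le0 ?rho0.
by rewrite inE !mulmx_linE divfK ?subrKC // (gt_eqF wk).
Qed.

Definition basis s := #|s| = d /\ indep R A s.

(** Coordinates with respect to a basis [s] of columns, extended by 0 off [s]: all
cells then share the index type of the columns. *)
Definition coord s : 'M[R]_(n, d) := csub s 1%:M *m pinvmx (csub s AR).

(** The point [c_s A_s^-1] at which the constraints of [s] are tight. *)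
Definition vertex c s : 'rV[R]_d := toR c *m coord s.

Lemma coord_off s j k : j \notin s -> coord s j k = 0.
Proof.
move=> js; rewrite mxE big1 // => i _; rewrite !mxE.
by case: eqP => [e|_]; rewrite ?mul0r //; rewrite e enum_valP in js.
Qed.

Lemma coord_supp s (v : 'cV[R]_d) : supported s (coord s *m v).
Proof. by move=> j js; rewrite mxE big1 // => k _; rewrite coord_off // mul0r. Qed.

Lemma mul_coord s : basis s -> AR *m coord s = 1%:M.
Proof.
move=> [sd si]; rewrite mulmxA -csub_mul mulmxVp //.
by rewrite /row_free (indep_rank si) sd.
Qed.

Lemma coordK s (v : 'cV[R]_d) : basis s -> AR *m (coord s *m v) = v.
Proof. by move=> sb; rewrite mulmxA mul_coord // mul1mx. Qed.

Lemma coord_col s (x : 'cV[R]_n) :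
  basis s -> supported s x -> coord s *m (AR *m x) = x.
Proof.
move=> sb xs; apply/eqP; rewrite -subr_eq0; apply/eqP; apply: (proj2 sb).
  by move=> j js; rewrite [LHS]mxE coord_supp // mxE xs // subr0.
by rewrite mulmxBr coordK // subrr.
Qed.

Lemma coord_inj s (v v' : 'cV[R]_d) :
  basis s -> coord s *m v = coord s *m v' -> v = v'.
Proof. by move=> sb e; rewrite -(coordK v sb) e coordK. Qed.

Lemma vertexE c s y : basis s ->
  (forall j, j \in s -> (y *m AR) 0 j = (c 0 j)%:~R) -> y = vertex c s.
Proof.
move=> sb ys; apply/matrixP => i k; rewrite ord1 /vertex [RHS]mxE.
rewrite -[in LHS](mulmx1 y) -(mul_coord sb).
rewrite mulmxA mxE; apply: eq_bigr => j _.
have [/ys->|js] := boolP (j \in s); first by rewrite [toR c 0 j]mxE.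
by rewrite coord_off ?mulr0.
Qed.

Hypothesis rkA : \rank AR = d.
Hypothesis posA : forall u : 'cV[R]_n, nonneg u -> AR *m u = 0 -> u = 0.

(** [posA] excludes the second branch of Gordan's alternative, and a functional
that is negative on all columns becomes dual feasible for [c] when multiplied by
a large number. *)
Lemma dual_feasible c : exists y, dual A c y.
Proof.
have [[y yA]|[u [u0 [i ui] e]]] := gordan (fun j => col j AR); last first.
  have : \col_j u j = 0.
    apply: posA => [j|]; first by rewrite mxE.
    by rewrite mulmx_sum_cols -[RHS]e; apply: eq_bigr => j _; rewrite mxE.
  by move=> /matrixP/(_ i 0); rewrite !mxE => ui0; rewrite ui0 ltxx in ui.
have {}yA j : 0 < - (y *m AR) 0 j.
  by rewrite oppr_gt0 -dot_colE map_col.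
exists ((\sum_j `|(c 0 j)%:~R| / - (y *m AR) 0 j) *: y) => k.
rewrite mulmx_linE -lerN2 -mulrN -ler_pdivrMr //.
rewrite (bigD1 k) //= -[leLHS]addr0 lerD ?sumr_ge0 //.
  by rewrite ler_pM2r ?invr_gt0 // -normrN ler_norm.
by move=> j _; rewrite divr_ge0 // ltW.
Qed.

Section Simplicial.
Variable c : 'rV[int]_n.
Hypothesis face_indep : forall s, faces R A c s -> indep R A s.

Lemma tight_face y : dual A c y -> faces R A c (tight A c y).
Proof. by move=> yc; apply/facesP; exists y. Qed.

(** A non-zero functional vanishes on a face with fewer than [d] elements; moving
the dual point along it makes one more constraint tight, so such a face is not
maximal. *)
Lemma maximal_face_basis s : maximal_face (faces R A c) s -> basis s.
Proof.
move=> [sf smax]; have si := face_indep sf; split=> //; apply/eqP.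
have rk := indep_rank si.
rewrite eqn_leq -{1}rk rank_leq_row /= leqNgt; apply/negP => lt_s_d.
have : ~~ row_free (csub s AR) by rewrite /row_free rk neq_ltn lt_s_d.
rewrite -kermx_eq0 => /rowV0Pn[w /sub_kermxP ws w0].
have {}ws j : j \in s -> (w *m AR) 0 j = 0.
  move=> js; have /matrixP/(_ 0 (enum_rank_in js j)) := ws.
  rewrite csub_mul mulmxA -csub_mul [LHS]mxE enum_rankK_in // => ->.
  by rewrite mxE.
have [k wk] : exists k, (w *m AR) 0 k != 0.
  have : w *m AR != 0 by rewrite mulmx_free_eq0 // /row_free rkA.
  by move=> /rV0Pn.
wlog wk_gt0 : w ws w0 wk / 0 < (w *m AR) 0 k.
  move=> IH; case: (ltrgtP ((w *m AR) 0 k) 0) => wk0.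
  - by apply: (IH (- w)); rewrite ?oppr_eq0 ?mulmx_linE ?oppr_eq0 ?oppr_gt0 // => j /ws;
      rewrite mulmx_linE => ->; rewrite oppr0.
  - exact: (IH w).
  - by rewrite wk0 eqxx in wk.
have /facesP[y yc ys] := sf.
have [t [i [t0 dy wi it]]] := ratio_test yc (ex_intro _ k wk_gt0).
have sub : s \subset tight A c (y + t *: w).
  apply/fintype.subsetP => j js; rewrite inE !mulmx_linE ws // mulr0 addr0.
  by rewrite ys inE in js.
have si' : i \in s by rewrite -(smax _ (tight_face dy) sub).
by rewrite ws // ltxx in wi.
Qed.

Lemma face_sub_maximal t : faces R A c t ->
  exists2 s, maximal_face (faces R A c) s & t \subset s.
Proof.
move=> tf; pose P s := `[< faces R A c s >].
have [s /maxsetP[/asboolP sf smax] ts] : {s | maxset P s & t \subset s}.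
  by apply: maxset_exists; apply/asboolP.
exists s => //; split=> // t' t'f st'; exact/smax/st'/asboolP.
Qed.

Lemma vertex_dual s : maximal_face (faces R A c) s ->
  dual A c (vertex c s) /\ tight A c (vertex c s) = s.
Proof.
move=> sm; have sb := maximal_face_basis sm.
have [/facesP[y yc ys] _] := sm.
have <- : y = vertex c s by apply: vertexE => // j; rewrite ys inE => /eqP.
by rewrite ys.
Qed.

Lemma vertex_eq s j : maximal_face (faces R A c) s -> j \in s ->
  (vertex c s *m AR) 0 j = (c 0 j)%:~R.
Proof. by move=> /vertex_dual[_ {1}<-]; rewrite inE => /eqP. Qed.

Lemma vertex_lt s j : maximal_face (faces R A c) s -> j \notin s ->
  (vertex c s *m AR) 0 j < (c 0 j)%:~R.
Proof.
move=> /vertex_dual[dy {1}<-]; rewrite inE => nj.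
by rewrite lt_neqAle nj dy.
Qed.

(** The dual simplex method: at a vertex of the dual polyhedron that is best
for [v], a negative coordinate of [v] would open an improving edge, and this
edge would have to be unbounded, which [v] in the cone forbids. *)
Lemma cone_cover v : cone A v ->
  exists2 s, maximal_face (faces R A c) s & nonneg (coord s *m v).
Proof.
move=> [u [u0 vE]].
have [y0 y0c] := dual_feasible c.
have [s0 s0m _] := face_sub_maximal (tight_face y0c).
pose f s := (vertex c s *m v) 0 0.
have [s /asboolP sm smax] := @arg_maxP _ R _ s0
  (fun s => `[< maximal_face (faces R A c) s >]) f (asboolT s0m).
exists s => // i; rewrite leNgt; apply/negP => vi.
have sb := maximal_face_basis sm.
have is_ : i \in s.
  by apply: contraLR vi => /coord_supp->; rewrite ltxx.
pose w := - row i (coord s).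
have wE x : (w *m x) 0 0 = - (coord s *m x) i 0.
  by rewrite mulmx_linE -row_mul mxE.
have wA j : j \in s -> (w *m AR) 0 j = - (j == i)%:R.
  move=> js; rewrite -dot_colE wE map_col colE coord_col //.
    by rewrite mxE eqxx andbT eq_sym.
  by move=> k ks; rewrite mxE andbT; case: eqP => // e; rewrite e js in ks.
have wv : 0 < (w *m v) 0 0 by rewrite wE oppr_gt0.
clearbody w.
have [k wk] : exists k, 0 < (w *m AR) 0 k.
  apply: contrapT => /forallNP wneg; move: wv; rewrite vE mulmxA mxE ltNge.
  by rewrite sumr_le0 // => k _; rewrite mulr_le0_ge0 // leNgt; apply/negP.
have [dy ty] := vertex_dual sm.
have [t [{k}k [t0 dy' {}wk kt]]] := ratio_test dy (ex_intro _ k wk).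
have ks : k \notin s.
  by apply/negP => ks; move: wk; rewrite wA // oppr_gt0 ltrn0.
have t_gt0 : 0 < t.
  rewrite lt_neqAle t0 andbT; apply: contraNneq ks => t_0.
  by rewrite -t_0 scale0r addr0 ty in kt.
pose y' := vertex c s + t *: w.
have sub : k |: (s :\ i) \subset tight A c y'.
  rewrite finset.subUset finset.sub1set kt /=; apply/fintype.subsetP => j; rewrite !inE => /andP[ji js].
  by rewrite !mulmx_linE wA // (negPf ji) oppr0 mulr0 addr0 vertex_eq.
have [s' s'm ts'] := face_sub_maximal (tight_face dy').
have s'b := maximal_face_basis s'm.
have s'E : s' = k |: (s :\ i).
  apply/esym/eqP; rewrite eqEcard (fintype.subset_trans sub ts') /=.
  rewrite (proj1 s'b) cardsU1 !inE (negPf ks) andbF /=.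
  by move: (cardsD1 i s); rewrite is_ (proj1 sb) => ->.
have y'E : y' = vertex c s'.
  apply: vertexE => // j js'; have := fintype.subsetP sub j; rewrite -s'E js' => /(_ isT).
  by rewrite inE => /eqP.
have : f s' <= f s := smax s' (asboolT s'm).
rewrite leNgt /f -y'E => /negP; apply.
by rewrite /y' !mulmx_linE ltrDl mulr_gt0.
Qed.

End Simplicial.
End Triangulation.

(** * Group relaxations *)

Lemma exists_min (T : Type) (P : T -> Prop) (f : T -> int) (B : int) :
  (forall x, P x -> B <= f x) -> (exists x, P x) ->
  exists x0, P x0 /\ forall x, P x -> f x0 <= f x.
Proof.
move=> fB [x1 Px1].
have [|m /asboolP[x [Px fx]] mmin] := @ex_minnP
    (fun m => `[< exists x, P x /\ f x = B + m%:Z >]).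
  exists `|f x1 - B|%N; apply/asboolP; exists x1; split=> //.
  by have := fB _ Px1; lia.
exists x; split=> // y Py; have fy := fB _ Py.
have /mmin : `[< exists x, P x /\ f x = B + (`|f y - B|%N)%:Z >].
  by apply/asboolP; exists y; split=> //; lia.
by lia.
Qed.

Lemma digits_inj (n : nat) (T : int) (x y : 'I_n -> int) :
  (forall i, 0 <= x i < T) -> (forall i, 0 <= y i < T) ->
  \sum_i x i * T ^+ i = \sum_i y i * T ^+ i -> x =1 y.
Proof.
elim: n x y => [|n IHn] x y xT yT; first by move=> _ [].
rewrite !big_ord_recl !mulr1.
have recT (z : 'I_n.+1 -> int) : \sum_(i < n) z (lift ord0 i) * T ^+ lift ord0 i =
    T * \sum_(i < n) z (lift ord0 i) * T ^+ i.
  by rewrite mulr_sumr; apply: eq_bigr => i _; rewrite exprS mulrCA.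
rewrite !recT; set X := \sum_(i < n) x _ * _; set Y := \sum_(i < n) y _ * _.
move=> e; have eXY : X = Y.
  have := xT ord0; have := yT ord0; move: e.
  by case: (ltrgtP X Y) => //; nia.
have e0 : x ord0 = y ord0 by move: e; rewrite eXY => /addIr.
have es := IHn _ _ (fun i => xT (lift ord0 i)) (fun i => yT (lift ord0 i)) eXY.
by move=> i; case: (unliftP ord0 i) => [j ->|->//]; apply: es.
Qed.

Lemma csub_rsub_sum (K : pzRingType) (m n : nat) (s : {set 'I_n})
    (M : 'M[K]_(m, n)) (x : 'cV[K]_n) i :
  (csub s M *m rsub s x) i 0 = \sum_(j in s) M i j * x j 0.
Proof. by rewrite mxE [RHS]big_enum_val; apply: eq_bigr => k _; rewrite !mxE. Qed.

Section GroupRelaxation.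
Variables (R : realType) (d n : nat) (A : 'M[int]_(d, n)).
Implicit Types (c : 'rV[int]_n) (s : {set 'I_n}) (b : 'cV[int]_d).
Local Notation toR := (map_mx (intr : int -> R)).
Local Notation AR := (toR A).

(** Feasibility for the group relaxation at [s], with basic and non-basic variables
in one vector. *)
Definition gfeas s b (x : 'cV[int]_n) :=
  A *m x = b /\ forall j, j \notin s -> 0 <= x j 0.

Definition gopt c s b x :=
  gfeas s b x /\ forall x', gfeas s b x' -> cost c x <= cost c x'.

Lemma group_feasibleE s b x : group_feasible A s b x <-> gfeas s b x.
Proof.
rewrite /group_feasible /gfeas.
have -> : csub s A *m rsub s x + csub (~: s) A *m rsub (~: s) x = A *m x.
  apply/matrixP => i k; rewrite ord1 mxE !csub_rsub_sum [RHS]mxE.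
  rewrite [RHS](bigID (mem s)) /=; congr (_ + _).
  by apply: eq_bigl => j; rewrite inE.
split=> -[-> x0]; split=> // j.
  move=> js; have js' : j \in ~: s by rewrite inE.
  by have := x0 (enum_rank_in js' j); rewrite mxE enum_rankK_in.
by rewrite mxE; apply: x0; have := enum_valP j; rewrite inE.
Qed.

Section FixedCost.
Variable c : 'rV[int]_n.
Hypothesis rkA : \rank AR = d.
Hypothesis face_indep : forall s, faces R A c s -> indep R A s.

(** The reduced costs are the slacks of the dual vertex of [s], so the group cost
and the cost differ by a term that depends on the right-hand side only. *)
Lemma group_costE s x : maximal_face (faces R A c) s ->
  group_cost R A c s x = (cost c x)%:~R - (vertex R A c s *m toR (A *m x)) 0 0.
Proof.
move=> sm; rewrite costE map_mxM gapE /group_cost.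
have -> : reduced_cost R A c s = csub (~: s) (toR c - vertex R A c s *m AR).
  rewrite /reduced_cost /vertex /coord (csub_mul (~: s) (_ - _)) mulmxBl.
  by rewrite (csub_mul (~: s)) (csub_mul s (toR c)) (csub_mul (~: s) AR) !mulmxA.
have -> : map_mx intr (rsub (~: s) x) = rsub (~: s) (toR x) :> 'cV[R]_#|~: s|.
  by apply/matrixP => i j; rewrite !mxE.
rewrite csub_rsub_sum [RHS](bigID (mem s)) /= [X in _ = X + _]big1 ?add0r.
  by apply: eq_big => [j|j _]; rewrite ?inE // [in LHS]mxE [in LHS]mxE [in X in _ + X]mxE.
by move=> j js; rewrite (vertex_eq rkA face_indep sm js) subrr mul0r.
Qed.

Lemma group_optimalE s b x : maximal_face (faces R A c) s ->
  group_optimal R A c s b x <-> gopt c s b x.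
Proof.
move=> sm; rewrite /group_optimal /gopt group_feasibleE.
split=> -[xf xmin]; split=> // x' x'f.
  have /xmin : group_feasible A s b x' by apply/group_feasibleE.
  by rewrite !group_costE // (proj1 xf) (proj1 x'f) lerD2r ler_int.
move/group_feasibleE in x'f.
by rewrite !group_costE // (proj1 xf) (proj1 x'f) lerD2r ler_int xmin.
Qed.

Lemma group_solvesE s b : maximal_face (faces R A c) s ->
  group_solves R A c s b <-> exists x, unique (gopt c s b) x /\ nonneg x.
Proof.
move=> sm; split=> -[x [[xo xu] x0]]; exists x; split=> //.
  by split=> [|x']; [exact/group_optimalE | move=> /(group_optimalE _ _ sm)/xu].
by split=> [|x']; [exact/group_optimalE | move=> /(group_optimalE _ _ sm)/xu].
Qed.

End FixedCost.

(** Pseudo-inverses commute with the extension of scalars from the rationals. *)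
Lemma coord_denominator :
  exists2 D : nat, (0 < D)%N &
    forall s b j, exists z : int,
      z%:~R = D%:R * (coord R A s *m toR b) j 0.
Proof.
pose AQ : 'M[rat]_(d, n) := map_mx intr A.
pose cQ s : 'M[rat]_(n, d) := csub s 1%:M *m pinvmx (csub s AQ).
have cE s : coord R A s = map_mx ratr (cQ s).
  rewrite /coord /cQ map_mxM map_pinvmx; congr (_ *m pinvmx _).
    by apply/matrixP => i j; rewrite !mxE rmorph_nat.
  by apply/matrixP => i j; rewrite !mxE rmorph_int.
have [D D0 Dc] := common_denominator
  (fun t : {set 'I_n} * 'I_n * 'I_d => cQ t.1.1 t.1.2 t.2).
exists D => // s b j.
exists (\sum_k sval (cid (Dc (s, j, k))) * b k 0).
rewrite mxE mulr_sumr rmorph_sum; apply: eq_bigr => k _.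
rewrite rmorphM /= mulrA [toR b k 0]mxE; congr (_ * _).
rewrite -[LHS]ratr_int (svalP (cid (Dc (s, j, k)))) rmorphM /= ratr_nat.
by rewrite cE [in RHS]mxE.
Qed.

End GroupRelaxation.

(** * Cost vectors adapted to a triangulation *)

Lemma sum_delta (K : pzRingType) (m n : nat) (M : 'M[K]_(m, n)) i (j : 'I_n) :
  (M *m (delta_mx j 0 : 'cV_n)) i 0 = M i j.
Proof. by rewrite -colE mxE. Qed.

Section Cells.
Variables (R : realType) (d n : nat) (A : 'M[int]_(d, n)).
Local Notation toR := (map_mx (intr : int -> R)).
Local Notation AR := (toR A).
Local Notation co s v := (coord R A s *m v).

Implicit Types (v : 'cV[R]_d) (s : {set 'I_n}) (y : 'rV[R]_d).

Lemma map_delta j : toR (delta_mx j 0 : 'cV[int]_n) = delta_mx j 0.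
Proof. by apply/matrixP => i k; rewrite !mxE; case: (_ && _). Qed.

Lemma map_colE j : toR (col j A) = AR *m delta_mx j 0.
Proof. by rewrite colE map_mxM map_delta. Qed.

Lemma coord_mulE s k j :
  (coord R A s *m AR) k j = (co s (toR (col j A))) k 0.
Proof. by rewrite map_colE mulmxA sum_delta. Qed.

Lemma nonneg_delta (F : numDomainType) j : nonneg (delta_mx j 0 : 'cV[F]_n).
Proof. by move=> k; rewrite mxE; case: (_ && _). Qed.

Lemma cone_col j : cone A (toR (col j A)).
Proof. by exists (delta_mx j 0); split; [exact: nonneg_delta | exact: map_colE]. Qed.

Lemma cone_NA b : in_NA A b -> cone A (toR b : 'cV[R]_d).
Proof.
move=> [x [x0 ->]]; exists (toR x); split; last by rewrite map_mxM.
by move=> j; rewrite mxE ler0z.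
Qed.

Lemma coord_vertex s j : basis R A s -> j \in s ->
  co s (toR (col j A)) = delta_mx j 0.
Proof.
move=> sb js; rewrite map_colE coord_col // => k ks.
by rewrite mxE andbT; case: eqP => // e; rewrite e js in ks.
Qed.

Variable c : 'rV[int]_n.
Hypothesis rkA : \rank AR = d.
Hypothesis posA : forall u : 'cV[R]_n, nonneg u -> AR *m u = 0 -> u = 0.
Hypothesis face_indep : forall s, faces R A c s -> indep R A s.
Local Notation MF s := (maximal_face (faces R A c) s).
Local Notation vx s := (vertex R A c s).

Lemma mf_basis s : MF s -> basis R A s.
Proof. exact: maximal_face_basis. Qed.

Lemma vertex_dot s v : (vx s *m v) 0 0 = (toR c *m co s v) 0 0.
Proof. by rewrite /vertex mulmxA. Qed.

Lemma dual_le_vertex y s v : dual A c y -> MF s -> nonneg (co s v) ->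
  (y *m v) 0 0 <= (vx s *m v) 0 0.
Proof.
move=> yc sm vs; rewrite vertex_dot -{1}(coordK v (mf_basis sm)).
by apply: weak_duality => // j _; apply: vs.
Qed.

Lemma dual_ge_vertex s s' v : MF s -> MF s' -> nonneg (co s v) ->
  (vx s *m v) 0 0 <= (vx s' *m v) 0 0 -> co s' v = co s v.
Proof.
move=> sm s'm vs le_v; have [dy ty] := vertex_dual rkA face_indep s'm.
rewrite -{1}(coordK v (mf_basis sm)) coord_col //; first exact: mf_basis.
rewrite -ty; apply: complementary_slackness => //.
by rewrite coordK -?vertex_dot //; apply: mf_basis.
Qed.

(** Both expansions of [v] are optimal for the linear relaxation, so by
complementary slackness for the dual vertex of [s'] the support of the one in
[s] is contained in [s']. *)
Lemma coord_agree s s' v : MF s -> MF s' ->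
  nonneg (co s v) -> nonneg (co s' v) -> co s' v = co s v.
Proof.
move=> sm s'm vs vs'; apply: dual_ge_vertex => //.
by apply: dual_le_vertex => //; have [] := vertex_dual rkA face_indep sm.
Qed.

Lemma coord_agree_vertex s s' j : MF s -> MF s' -> j \in s ->
  nonneg (co s' (toR (col j A))) -> j \in s'.
Proof.
move=> sm s'm js js'; have := coord_agree sm s'm _ js'.
rewrite coord_vertex //; last exact: mf_basis.
move=> /(_ (@nonneg_delta _ j))/matrixP/(_ j 0); rewrite [RHS]mxE !eqxx => e.
by apply: contra_eqT e => /coord_supp->; rewrite eq_sym oner_neq0.
Qed.

Lemma real_col_neq0 j : toR (col j A) != 0.
Proof.
apply/eqP; rewrite map_colE => /(posA (@nonneg_delta _ j))/matrixP/(_ j 0).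
by rewrite !mxE !eqxx => /eqP; rewrite oner_eq0.
Qed.

End Cells.

Section GomoryCost.
Variables (R : realType) (d n : nat) (A : 'M[int]_(d, n)) (c : 'rV[int]_n).
Local Notation toR := (map_mx (intr : int -> R)).
Local Notation AR := (toR A).
Local Notation co s v := (coord R A s *m v).
Hypothesis rkA : \rank AR = d.
Hypothesis posA : forall u : 'cV[R]_n, nonneg u -> AR *m u = 0 -> u = 0.
Hypothesis face_indep : forall s, faces R A c s -> indep R A s.
Local Notation MF s := (maximal_face (faces R A c) s).
Local Notation vx s := (vertex R A c s).
Local Notation "'a_ j" := (toR (col j A)) (at level 8, j at level 2, format "''a_' j").

Variable D : nat.
Hypothesis D_gt0 : (0 < D)%N.
Variable zc : {set 'I_n} -> 'cV[int]_d -> 'I_n -> int.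
Hypothesis zcE : forall s b j, (zc s b j)%:~R = D%:R * (co s (toR b)) j 0.
Variable cell : 'I_n -> {set 'I_n}.
Hypothesis cell_max : forall j, MF (cell j).
Hypothesis cell_col : forall j, nonneg (co (cell j) 'a_j).

(** [D] times the piecewise linear interpolation, at column [j], of the costs of the
vertices of the triangulation; [D] clears the denominators of all coordinates. *)
Definition lift_height j : int := \sum_k c 0 k * zc (cell j) (col j A) k.

(** [D] times the piecewise linear function that is 1 at every vertex of the
triangulation. *)
Definition simplex_height j : int := \sum_k zc (cell j) (col j A) k.

(** Exceeds every entry of the coefficient vectors between which ties are broken. *)
Definition base : int := (d * D).+1.

Definition tie_bound : int := \sum_(j < n) (d * D)%:Z * base ^+ j.

Definition fine_scale : int := tie_bound + 1.

(** The scales separate three criteria: one unit of [lift_height] outweighs all that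
the simplex heights of a parallelepiped can contribute, and one unit of
[simplex_height] outweighs all ties. *)
Definition coarse_scale : int := fine_scale * (D * d)%:Z + tie_bound + 1.

Definition correction j : int :=
  if j \in cell j then 0 else fine_scale * simplex_height j + base ^+ j.

(** Vertices keep their cost up to a factor.  The other columns are placed above
the interpolation of these costs by an amount that is dominated by
[simplex_height], with powers of [base] to break ties. *)
Definition gomory_cost : 'rV[int]_n :=
  \row_j (coarse_scale * lift_height j + correction j).

Local Notation V j := ((vx (cell j) *m AR) 0 j).
Local Notation KD := (coarse_scale%:~R * D%:R : R).

Lemma D_gt0R : 0 < D%:R :> R. Proof. by rewrite ltr0n. Qed.

Lemma base_gt0 j : 0 < base ^+ j.
Proof. by rewrite exprn_gt0. Qed.

Lemma tie_bound_ge0 : 0 <= tie_bound.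
Proof. by apply: sumr_ge0 => j _; rewrite mulr_ge0 // ltW // base_gt0. Qed.

Lemma fine_gt0 : 0 < fine_scale.
Proof. by rewrite /fine_scale; have := tie_bound_ge0; lia. Qed.

Lemma coarse_gt0 : 0 < coarse_scale.
Proof.
rewrite /coarse_scale; have := tie_bound_ge0; have := fine_gt0.
by have : 0 <= (D * d)%:Z by []; nia.
Qed.

Lemma KD_gt0 : 0 < KD.
Proof. by rewrite mulr_gt0 ?D_gt0R // ltr0z coarse_gt0. Qed.

Lemma simplex_heightE j :
  (simplex_height j)%:~R = D%:R * \sum_k co (cell j) 'a_j k 0 :> R.
Proof.
rewrite /simplex_height rmorph_sum mulr_sumr /=.
by apply: eq_bigr => k _; rewrite zcE.
Qed.

Lemma zc_dot s j :
  (\sum_k c 0 k * zc s (col j A) k)%:~R = D%:R * (vx s *m AR) 0 j :> R.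
Proof.
rewrite -dot_colE vertex_dot mxE mulr_sumr rmorph_sum /=.
by apply: eq_bigr => k _; rewrite rmorphM /= zcE mulrCA [toR c 0 k]mxE.
Qed.

Lemma simplex_height_gt0 j : 0 < simplex_height j.
Proof.
rewrite -(ltr0z R) simplex_heightE mulr_gt0 ?D_gt0R //.
rewrite lt0r sumr_ge0 ?andbT; last by move=> k _; apply: cell_col.
apply/eqP => e0; have := real_col_neq0 posA j.
rewrite -(coordK 'a_j (mf_basis rkA face_indep (cell_max j))).
suff -> : co (cell j) 'a_j = 0 by rewrite mulmx0 eqxx.
apply/matrixP => k i; rewrite ord1 [RHS]mxE.
by rewrite (psumr_eq0P _ e0) // => l _; apply: cell_col.
Qed.

Lemma correction_ge0 j : 0 <= correction j.
Proof.
rewrite /correction; case: ifP => // _.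
by have := simplex_height_gt0 j; have := base_gt0 j; have := fine_gt0; nia.
Qed.

Lemma correction_gt0 j : j \notin cell j -> 0 < correction j.
Proof.
rewrite /correction => /negPf ->.
by have := simplex_height_gt0 j; have := base_gt0 j; have := fine_gt0; nia.
Qed.

Lemma gomory_costE j :
  (gomory_cost 0 j)%:~R = KD * V j + (correction j)%:~R :> R.
Proof. by rewrite mxE rmorphD rmorphM /= zc_dot mulrA. Qed.

Lemma V_le j : V j <= (c 0 j)%:~R.
Proof. by have [dy _] := vertex_dual rkA face_indep (cell_max j); apply: dy. Qed.

Lemma cell_vertex s k : MF s -> k \in s -> k \in cell k.
Proof. by move=> sm ks; apply: (coord_agree_vertex rkA face_indep sm). Qed.

Lemma V_vertex j : j \in cell j -> V j = (c 0 j)%:~R.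
Proof. exact: vertex_eq. Qed.

Lemma V_nonvertex j : j \notin cell j -> V j < (c 0 j)%:~R.
Proof. exact: vertex_lt. Qed.

Lemma dual_le_V y j : dual A c y -> (y *m AR) 0 j <= V j.
Proof.
by move=> yc; rewrite -[leLHS]dot_colE -[leRHS]dot_colE; apply: (dual_le_vertex rkA face_indep).
Qed.

(** The vertices keep their costs and the other columns stay strictly above the
lower envelope, so no constraint becomes tight or stops being tight. *)
Lemma dual_scale y : dual A c y ->
  dual A gomory_cost (KD *: y) /\
  tight A gomory_cost (KD *: y) = tight A c y.
Proof.
move=> yc; have K0 := KD_gt0.
have le_c j : KD * (y *m AR) 0 j <= KD * V j by rewrite ler_pM2l // dual_le_V.
split=> [j|].
  rewrite mulmx_linE gomory_costE -[leLHS]addr0 lerD // ler0z.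
  exact: correction_ge0.
apply/setP => j; rewrite !inE mulmx_linE gomory_costE.
have [jc|jc] := boolP (j \in cell j).
  rewrite /correction jc addr0 V_vertex //.
  by rewrite (inj_eq (mulfI (lt0r_neq0 K0))).
rewrite !lt_eqF //; first exact: le_lt_trans (dual_le_V _ yc) (V_nonvertex jc).
by rewrite (le_lt_trans (le_c j)) // ltrDl ltr0z correction_gt0.
Qed.

(** Every column is a non-negative combination of vertices, at which the two cost
vectors agree up to the scale. *)
Lemma dual_unscale y : dual A gomory_cost y -> dual A c (KD^-1 *: y).
Proof.
move=> yc j; apply: le_trans (V_le j).
rewrite mulmx_linE ler_pdivrMl ?KD_gt0 // -[leLHS]dot_colE -[X in KD * X]dot_colE.
have cb := mf_basis rkA face_indep (cell_max j).
rewrite vertex_dot -[X in (y *m X) 0 0](coordK _ cb) mulmxA mxE mxE mulr_sumr.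
apply: ler_sum => k _; rewrite [toR c 0 k]mxE mulrA.
have [kc|kc] := boolP (k \in cell j); last by rewrite coord_supp // !mulr0.
rewrite ler_wpM2r ?cell_col //; have kk := cell_vertex (cell_max j) kc.
by have := yc k; rewrite gomory_costE /correction kk addr0 V_vertex.
Qed.

Lemma faces_gomory_cost : faces R A gomory_cost = faces R A c.
Proof.
apply/funext => s; apply/propext; split=> /facesP[y yc ->].
  apply/facesP; exists (KD^-1 *: y); first exact: dual_unscale.
  have [_ <-] := dual_scale (dual_unscale yc).
  by rewrite scalerA divff ?scale1r // lt0r_neq0 // KD_gt0.
by have [dy ty] := dual_scale yc; apply/facesP; exists (KD *: y).
Qed.

Hypothesis cell_normal : forall s (b : 'cV[int]_d),
  MF s -> nonneg (co s (toR b)) ->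
  exists x : 'cV[int]_n, [/\ nonneg x, A *m x = b &
    forall j, x j 0 != 0 -> nonneg (co s 'a_j)].

Definition red s j : R := (gomory_cost 0 j)%:~R - KD * (vx s *m AR) 0 j.

Definition ties (x : 'cV[int]_n) : int := \sum_j x j 0 * base ^+ j.

Lemma red_face s j : MF s -> j \in s -> red s j = 0.
Proof.
move=> sm js; have jj := cell_vertex sm js.
rewrite /red gomory_costE /correction jj addr0 V_vertex //.
by rewrite (vertex_eq rkA face_indep) // subrr.
Qed.

Lemma red_cone s j : MF s -> j \notin s -> nonneg (co s 'a_j) ->
  red s j = (fine_scale * simplex_height j + base ^+ j)%:~R.
Proof.
move=> sm js sj; rewrite /red gomory_costE /correction.
have /negPf -> : j \notin cell j.
  by apply: contra js => jj; apply: (coord_agree_vertex rkA face_indep (cell_max j)).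
suff -> : V j = (vx s *m AR) 0 j by rewrite addrC addKr.
rewrite -[LHS]dot_colE -[RHS]dot_colE !vertex_dot.
by rewrite (coord_agree rkA face_indep (cell_max j) sm).
Qed.

(** [D] times the slack is a positive integer, hence at least 1. *)
Lemma red_out s j : MF s -> ~ nonneg (co s 'a_j) -> coarse_scale%:~R <= red s j.
Proof.
move=> sm sj; rewrite /red gomory_costE.
suff le1 : 1 <= D%:R * (V j - (vx s *m AR) 0 j).
  have -> : forall t v w : R, KD * v + t - KD * w =
      coarse_scale%:~R * (D%:R * (v - w)) + t by move=> *; ring.
  rewrite -[leLHS]addr0 lerD ?ler0z ?correction_ge0 // ler_peMr // ler0z.
  exact/ltW/coarse_gt0.
rewrite mulrBr -!zc_dot -rmorphB ler1z -gtz0_ge1 -(ltr0z R) rmorphB /= !zc_dot.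
rewrite -mulrBr mulr_gt0 ?D_gt0R // subr_gt0 ltNge; apply/negP => le_V.
apply: sj; rewrite (dual_ge_vertex rkA face_indep (cell_max j) sm) //.
by rewrite !dot_colE.
Qed.

Lemma red_ge0 s j : MF s -> 0 <= red s j.
Proof.
move=> sm; have [dy _] := vertex_dual rkA face_indep sm.
by have [+ _] := dual_scale dy; move=> /(_ j); rewrite mulmx_linE subr_ge0.
Qed.

Lemma cost_red s (x : 'cV[int]_n) :
  (cost gomory_cost x)%:~R =
  KD * (vx s *m toR (A *m x)) 0 0 + \sum_j red s j * (x j 0)%:~R.
Proof.
rewrite costE map_mxM; apply/eqP; rewrite addrC -subr_eq -mulmx_linE gapE.
by apply/eqP; apply: eq_bigr => j _; rewrite /red mulmx_linE [toR x j 0]mxE.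
Qed.

Lemma sum_simplex_height s (x : 'cV[int]_n) : MF s ->
  (forall j, x j 0 != 0 -> nonneg (co s 'a_j)) ->
  (\sum_j x j 0 * simplex_height j)%:~R =
  D%:R * \sum_k (co s (toR (A *m x))) k 0.
Proof.
move=> sm xs; rewrite rmorph_sum /=.
transitivity (\sum_j D%:R * (\sum_k (x j 0)%:~R * (co s 'a_j) k 0)).
  apply: eq_bigr => j _; rewrite rmorphM /= simplex_heightE mulrCA -mulr_sumr.
  have [->|/xs sj] := eqVneq (x j 0) 0; first by rewrite !mul0r.
  by rewrite (coord_agree rkA face_indep (cell_max j) sm).
rewrite -mulr_sumr exchange_big; congr (_ * _); apply: eq_bigr => k _ /=.
rewrite map_mxM mulmxA mxE; apply: eq_bigr => j _.
by rewrite coord_mulE [toR x j 0]mxE mulrC.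
Qed.

(** The correction makes the cost of a group solution, up to ties, the sum of
the coordinates it takes away from the basic variables.  Inside the cone of
[s] these coordinates are non-negative and fixed modulo 1, so the minimum is
the fractional part, which leaves the basic variables non-negative. *)
Lemma gomory_group_optimum s (b : 'cV[int]_d) :
  MF s -> nonneg (co s (toR b)) ->
  exists z, unique (gopt A gomory_cost s b) z /\ nonneg z.
Proof.
move=> sm bs; have sb := mf_basis rkA face_indep sm.
pose fl : 'cV[int]_n := \col_j Num.floor ((co s (toR b)) j 0).
have fl0 : nonneg fl by move=> j; rewrite mxE floor_ge0.
have fls : supported s fl by move=> j js; rewrite mxE coord_supp // floor0.
pose b' := b - A *m fl.
have coA (u : 'cV[int]_n) : supported s u -> co s (toR (A *m u)) = toR u.
  by move=> us; rewrite map_mxM coord_col // => j js; rewrite mxE us.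
have cob' : co s (toR b') = co s (toR b) - toR fl.
  by rewrite /b' map_mxB mulmxBr coA.
have b'itv k : 0 <= (co s (toR b')) k 0 < 1.
  rewrite cob' !mxE subr_ge0 floor_le /= ltrBlDl.
  by have := floorD1_gt ((co s (toR b)) k 0); rewrite rmorphD /= !mxE.
clearbody fl.
have b's : nonneg (co s (toR b')) by move=> k; case/andP: (b'itv k).
pose X (x : 'cV[int]_n) := [/\ nonneg x, A *m x = b' &
    forall j, x j 0 != 0 -> nonneg (co s 'a_j)].
have ties0 x : X x -> 0 <= ties x.
  by move=> [x0 _ _]; apply: sumr_ge0 => j _; rewrite mulr_ge0 // ltW // base_gt0.
have [x0 [Xx0 x0min]] := exists_min ties0 (cell_normal sm b's).
pose phi := \sum_k (co s (toR b')) k 0.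
have phi_le : phi <= d%:R.
  have -> : d%:R = \sum_(k in s) 1 :> R by rewrite sumr_const (proj1 sb).
  rewrite /phi (bigID (mem s)) /= [X in _ + X]big1 ?addr0.
    by apply: ler_sum => k _; case/andP: (b'itv k) => _ /ltW.
  by move=> k ks; rewrite coord_supp.
have heights x : X x -> (\sum_j x j 0 * simplex_height j)%:~R = D%:R * phi.
  by move=> [_ Ax xs]; rewrite (sum_simplex_height sm) // Ax.
have x_small x : X x -> forall j, 0 <= x j 0 <= (d * D)%:Z.
  move=> Xx j; have [xx0 _ _] := Xx; rewrite xx0 /=.
  apply: (@le_trans _ _ (\sum_j x j 0 * simplex_height j)).
    rewrite (bigD1 j) //= -[leLHS]addr0 lerD ?sumr_ge0 //.
      by rewrite ler_peMr ?xx0 // -gtz0_ge1 simplex_height_gt0.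
    by move=> k _; rewrite mulr_ge0 // ltW // simplex_height_gt0.
  rewrite -(ler_int R) heights //.
  have -> : (d * D)%:Z%:~R = D%:R * d%:R :> R by rewrite mulnC -natrM.
  by rewrite ler_pM2l // D_gt0R.
have ties_le x : X x -> ties x <= tie_bound.
  move=> Xx; apply: ler_sum => j _; rewrite ler_pM2r ?base_gt0 //.
  by case/andP: (x_small x Xx j).
have Xs x : X x -> forall j, j \in s -> x j 0 = 0.
  move=> Xx j js; have [xx0 Ax xs] := Xx; apply/eqP; rewrite eq_le xx0 andbT.
  rewrite -ltzD1 add0r -(ltr_int R) (le_lt_trans _ (proj2 (andP (b'itv j)))) //.
  rewrite -Ax map_mxM mulmxA mxE (bigD1 j) //= -[leLHS]addr0 lerD ?sumr_ge0 //.
    by rewrite coord_mulE coord_vertex // !mxE !eqxx mul1r.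
  move=> k _; rewrite coord_mulE [toR x k 0]mxE.
  have [->|/xs xk] := eqVneq (x k 0) 0; first by rewrite mulr0.
  by rewrite mulr_ge0 ?ler0z.
pose Rc (z : 'cV[int]_n) := \sum_j red s j * (z j 0)%:~R.
(* Inside the cone the slacks vanish and only the correction is paid. *)
have Rc_cone (z u : 'cV[int]_n) :
    (forall j, j \notin s -> z j 0 = u j 0) -> (forall j, j \in s -> u j 0 = 0) ->
    (forall j, u j 0 != 0 -> nonneg (co s 'a_j)) ->
    Rc z = fine_scale%:~R * (\sum_j u j 0 * simplex_height j)%:~R + (ties u)%:~R.
  move=> zu u_s us; rewrite -rmorphM -rmorphD /= mulr_sumr -big_split /= rmorph_sum.
  apply: eq_bigr => j _ /=; have [js|js] := boolP (j \in s).
    by rewrite red_face // u_s // !mul0r mulr0.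
  have [uj|uj] := eqVneq (u j 0) 0; first by rewrite zu // uj !mul0r mulr0 mulr0.
  rewrite (red_cone sm js (us _ uj)) zu // -rmorphM; congr (_%:~R).
  by ring.
pose z0 := x0 + fl.
have Rz0 : Rc z0 = fine_scale%:~R * (D%:R * phi) + (ties x0)%:~R.
  rewrite -(heights _ Xx0); apply: Rc_cone; last by case: Xx0.
    by move=> j js; rewrite mxE fls // addr0.
  exact: Xs.
have z0f : gfeas A s b z0.
  have [x0_ge0 Ax0 _] := Xx0.
  split; first by rewrite mulmxDr Ax0 /b' subrK.
  by move=> j js; rewrite mxE fls // addr0.
have z0_ge0 : nonneg z0 by have [? _ _] := Xx0; move=> j; rewrite mxE addr_ge0.
have key z : gfeas A s b z -> Rc z <= Rc z0 -> z = z0.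
  move=> [Az z_ge0] le_z.
  (* One column outside the cone costs more than all of [z0]. *)
  have z_cone j : j \notin s -> z j 0 != 0 -> nonneg (co s 'a_j).
    move=> js zj; apply: contrapT => sj.
    have zj1 : 1 <= z j 0 by have := z_ge0 j js; move: zj; lia.
    have : coarse_scale%:~R <= Rc z.
      rewrite /Rc (bigD1 j) //= -[leLHS]addr0 lerD //.
        rewrite -[leLHS]mulr1 ler_pM ?ler0z ?ler1z ?(ltW coarse_gt0) //.
        exact: red_out.
      apply: sumr_ge0 => k _; have [ks|ks] := boolP (k \in s).
        by rewrite red_face // mul0r.
      by rewrite mulr_ge0 ?red_ge0 // ler0z z_ge0.
    move=> /le_trans/(_ le_z); rewrite Rz0 leNgt => /negP; apply.
    apply: (@le_lt_trans _ _ (fine_scale * (D * d)%:Z + tie_bound)%:~R); last first.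
      by rewrite ltr_int /coarse_scale ltrDl.
    rewrite [leRHS]intrD [X in _ <= X + _]intrM lerD ?ler_int ?ties_le //.
    have -> : (D * d)%:Z%:~R = D%:R * d%:R :> R by rewrite -natrM.
    by rewrite ler_pM2l ?ltr0z ?fine_gt0 // ler_pM2l // D_gt0R.
  pose u : 'cV[int]_n := \col_j (if j \in s then 0 else z j 0).
  have u_s j : j \in s -> u j 0 = 0 by move=> js; rewrite mxE js.
  have zu j : j \notin s -> z j 0 = u j 0 by move=> /negPf js; rewrite mxE js.
  have u_ge0 : nonneg u by move=> j; rewrite mxE; case: ifPn => // /z_ge0.
  have u_cone j : u j 0 != 0 -> nonneg (co s 'a_j).
    have [/u_s->|js] := boolP (j \in s); first by rewrite eqxx.
    by rewrite -zu // => /z_cone; apply.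
  (* [m] is what [z] moves from the basic to the free variables, compared with
     [z0]; positivity of the coordinates forces it to be non-negative. *)
  pose m := fl - (z - u).
  have ms : supported s m by move=> j js; rewrite !mxE (negPf js) fls // subrr subr0.
  have Au : A *m u = b' + A *m m.
    by rewrite /m /b' !mulmxBr Az opprB addrA subrK subrKC.
  have rho : co s (toR (A *m u)) = co s (toR b') + toR m.
    by rewrite Au map_mxD mulmxDr coA.
  have rho0 : nonneg (co s (toR (A *m u))).
    move=> k; rewrite map_mxM mulmxA mxE sumr_ge0 // => j _.
    rewrite coord_mulE [toR u j 0]mxE.
    have [->|/u_cone uj] := eqVneq (u j 0) 0; first by rewrite mulr0.
    by rewrite mulr_ge0 ?ler0z.
  have m0 : nonneg m.
    move=> k; have := rho0 k; rewrite rho mxE [toR m k 0]mxE => ge0.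
    have /andP[_ lt1] := b'itv k.
    have : (-1)%:~R < (m k 0)%:~R :> R by rewrite mulrN1z; lra.
    by rewrite ltr_int -lezD1.
  have Rz : Rc z = fine_scale%:~R * (D%:R * (phi + (\sum_k m k 0)%:~R)) + (ties u)%:~R.
    rewrite (Rc_cone z u) // (sum_simplex_height sm) // rho.
    congr (_ * (_ * _) + _); rewrite /phi rmorph_sum -big_split.
    by apply: eq_bigr => k _; rewrite mxE [toR m k 0]mxE.
  have ties_u : 0 <= ties u.
    by apply: sumr_ge0 => j _; rewrite mulr_ge0 // ltW // base_gt0.
  have sum_m0 : \sum_k m k 0 = 0.
    apply/eqP; rewrite eq_le sumr_ge0 ?andbT; last by move=> k _; apply: m0.
    rewrite leNgt; apply/negP => m_gt0.
    move: le_z; rewrite Rz Rz0 leNgt => /negP; apply.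
    rewrite [D%:R * (phi + _)]mulrDr [fine_scale%:~R * (_ + _)]mulrDr.
    rewrite -[ltRHS]addrA ltrD2l.
    apply: (@le_lt_trans _ _ tie_bound%:~R); first by rewrite ler_int ties_le.
    apply: (@lt_le_trans _ _ (fine_scale * (D%:Z * \sum_k m k 0))%:~R).
      rewrite ltr_int; have := tie_bound_ge0; have := fine_gt0.
      move: D_gt0 m_gt0; set S := \sum_k _; rewrite /fine_scale => D1 S1 f1 t0.
      by have : 1 <= D%:Z * S by [nia]; nia.
    by rewrite !intrM -pmulrn lerDl ler0z.
  have {}m0 : m = 0.
    apply/matrixP => k i; rewrite ord1 [RHS]mxE.
    by apply: (psumr_eq0P _ sum_m0) => // l _; apply: m0.
  have Xu : X u by split=> //; rewrite Au m0 mulmx0 addr0.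
  have ties_eq : ties u = ties x0.
    apply/eqP; rewrite eq_le x0min // andbT.
    by move: le_z; rewrite Rz Rz0 sum_m0 addr0 lerD2l ler_int.
  have ux0 : u = x0.
    apply/matrixP => j i; rewrite ord1.
    have lt_base x : X x -> forall j, 0 <= x j 0 < base.
      by move=> Xx k; have /andP[-> le_x] := x_small x Xx k; rewrite /base; lia.
    exact: (digits_inj (lt_base u Xu) (lt_base x0 Xx0) ties_eq).
  rewrite /z0 -ux0; move: m0 => /eqP; rewrite subr_eq0 => /eqP ->.
  by rewrite addrC subrK.
have Rc_cost z z' : gfeas A s b z -> gfeas A s b z' ->
    (cost gomory_cost z <= cost gomory_cost z') = (Rc z <= Rc z').
  by move=> [Az _] [Az' _]; rewrite -(ler_int R) !(cost_red s) Az Az' lerD2l.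
exists z0; split=> //; split.
  split=> // z' z'f; rewrite Rc_cost // leNgt; apply/negP => lt_z'.
  by move: (lt_z'); rewrite (key _ z'f (ltW lt_z')) ltxx.
by move=> z' [z'f z'min]; rewrite (key z') // -Rc_cost // z'min.
Qed.

End GomoryCost.

(** * Cells generated by their columns *)

Section CellNormal.
Variables (R : realType) (d n : nat) (A : 'M[int]_(d, n)).
Implicit Types (s : {set 'I_n}) (c : 'rV[int]_n) (b : 'cV[int]_d).
Local Notation toR := (map_mx (intr : int -> R)).
Local Notation AR := (toR A).
Local Notation co s v := (coord R A s *m v).
Local Notation "'a_ j" := (toR (col j A)) (at level 8, j at level 2, format "''a_' j").

(** Delta-normality at a single cell, in terms of coefficient vectors. *)
Definition cell_normal s := forall b : 'cV[int]_d,
  nonneg (co s (toR b)) ->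
  exists x : 'cV[int]_n, [/\ nonneg x, A *m x = b &
    forall j, x j 0 != 0 -> nonneg (co s 'a_j)].

Lemma gopt_optimal c s b z :
  unique (gopt A c s b) z -> nonneg z -> unique (optimal A c b) z.
Proof.
move=> [[[Az _] zmin] zu] z0.
have gf x : feasible A b x -> gfeas A s b x by move=> [Ax x0]; split.
split; first by split=> // x /gf/zmin.
move=> x [xf xmin]; apply: zu; split=> [|x' x'f]; first exact: gf.
by apply: le_trans (zmin _ x'f); apply: xmin.
Qed.

Lemma cone_csubE s (v : 'cV[R]_d) : basis R A s ->
  cone (csub s A) v <-> nonneg (co s v).
Proof.
move=> sb; have mapE : toR (csub s A) = csub s AR.
  by apply/matrixP => i j; rewrite !mxE.
split=> [[u [u0 ->]]|v0].
  rewrite mapE csub_mul -mulmxA coord_col //; last exact: supported_csub.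
  move=> j; rewrite mxE sumr_ge0 // => k _.
  by rewrite mulr_ge0 ?u0 // !mxE; case: (_ == _).
exists (rsub s (co s v)); split; first by move=> j; rewrite mxE.
by rewrite mapE csub_mul -mulmxA csub_rsub ?coordK //; apply: coord_supp.
Qed.

Lemma sum_cols (V : nmodType) (F : 'cV[int]_d -> V) :
  \sum_(h <- cols A) F h = \sum_j F (col j A).
Proof. by rewrite /cols big_map big_enum. Qed.

Hypothesis rkA : \rank AR = d.
Hypothesis posA : forall u : 'cV[R]_n, nonneg u -> AR *m u = 0 -> u = 0.

Lemma Delta_normal_cell_normal c s :
  (forall t, faces R A c t -> indep R A t) ->
  Delta_normal R A (faces R A c) -> maximal_face (faces R A c) s ->
  cell_normal s.
Proof.
move=> cind nrm sm b; have sb := mf_basis rkA cind sm.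
have [_ gen] := nrm s sm.
move=> /(cone_csubE _ sb)/gen[k ->].
pose P (a : 'cV[int]_d) := `[< cone (csub s A) (toR a) >].
exists (\col_j (if P (col j A) then (k (col j A))%:Z else 0)); split.
- by move=> j; rewrite mxE; case: ifP.
- rewrite mulmx_sum_cols [RHS]big_filter [RHS]big_mkcond [RHS]sum_cols.
  apply: eq_bigr => j _; rewrite mxE -/(P _).
  by case: ifP => _; rewrite ?scale0r // -natz scaler_nat.
- move=> j; rewrite mxE; case: ifPn => [/asboolP pj _|_]; last by rewrite eqxx.
  exact/(cone_csubE _ sb).
Qed.

(** With the adapted cost vector, the group optimum at a cell that contains the
right-hand side is non-negative; being unique, it is also the unique optimum of
the integer program, which makes the cost vector generic. *)
Theorem supports_of_cell_normal c :
  (forall t, faces R A c t -> indep R A t) ->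
  (forall s, maximal_face (faces R A c) s -> cell_normal s) ->
  exists c', supports R A (faces R A c) c'.
Proof.
move=> cind cnorm.
have [D D0 zP] := coord_denominator R A.
pose zc s b j := sval (cid (zP s b j)).
have zcE s b j : (zc s b j)%:~R = D%:R * (co s (toR b)) j 0 by exact: svalP (cid (zP s b j)).
have cellP j := cid2 (cone_cover rkA posA cind (cone_col R A j)).
pose cell j := s2val (cellP j).
have cell_max j : maximal_face (faces R A c) (cell j) by exact: s2valP (cellP j).
have cell_col j : nonneg (co (cell j) 'a_j) by exact: s2valP' (cellP j).
pose c' := gomory_cost A c D zc cell.
have fE : faces R A c' = faces R A c.
  exact: (faces_gomory_cost rkA posA cind D0 zcE cell_max cell_col).
have cind' t : faces R A c' t -> indep R A t by rewrite fE; apply: cind.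
have sol b : in_NA A b -> exists2 s, maximal_face (faces R A c) s &
    exists z, unique (gopt A c' s b) z /\ nonneg z.
  move=> /(cone_NA R)/(cone_cover rkA posA cind)[s sm bs]; exists s => //.
  apply: (gomory_group_optimum rkA posA cind D0 zcE cell_max cell_col _ sm bs).
  by move=> t b' /cnorm/(_ b').
exists c'; split=> // [b /sol[s _ [z [zo z0]]]|b /sol[s sm zs]].
  by exists z; apply: gopt_optimal zo z0.
by exists s; rewrite fE; split=> //; apply/group_solvesE; rewrite ?fE.
Qed.

Hypothesis colsU : uniq (cols A).

Lemma posZ (x : 'cV[int]_n) : nonneg x -> A *m x = 0 -> x = 0.
Proof.
move=> x0 Ax; have /matrixP e : toR x = 0.
  apply: posA; first by move=> j; rewrite mxE ler0z.
  by rewrite -map_mxM Ax map_mx0.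
by apply/matrixP => i j; have := e i j; rewrite !mxE => /eqP; rewrite intr_eq0 => /eqP.
Qed.

Lemma col_inj : injective (fun j => col j A).
Proof. exact/injectiveP. Qed.

(** A non-trivial representation of a column would make it redundant in the
Hilbert basis. *)
Lemma irreducible_col (x : 'cV[int]_n) j :
  minimal_hilbert_basis (cols A) (@cone R d n A) ->
  nonneg x -> A *m x = col j A -> x = delta_mx j 0.
Proof.
move=> [[_ gen] hmin] x0 Ax.
have [xj|xj] := ltP 0 (x j 0).
  apply/eqP; rewrite -subr_eq0; apply/eqP/posZ.
    move=> k; rewrite !mxE andbT; have := x0 k.
    by case: eqP => [->|_] /=; rewrite subr_ge0 // -gtz0_ge1.
  by rewrite mulmxBr Ax colE subrr.
have {}xj : x j 0 = 0 by apply/eqP; rewrite eq_le xj x0.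
pose H := [seq h <- cols A | h != col j A].
suff HH : hilbert_basis H (@cone R d n A).
  have : {subset cols A <= H} by apply: hmin HH (mem_subseq (filter_subseq _ _)).
  have cj : col j A \in cols A by apply: map_f; rewrite mem_enum.
  by move=> /(_ _ cj); rewrite mem_filter eqxx.
split=> [h|b].
  by rewrite mem_filter => /andP[_ /mapP[k _ ->]]; apply: cone_col.
move=> /gen[k ->].
pose m i : nat := absz (x i 0).
exists (fun h => (k h + k (col j A) * \sum_(i | col i A == h) m i)%N).
rewrite [RHS]big_filter [RHS]big_mkcond !sum_cols (bigD1 j) //= [RHS](bigD1 j) //= eqxx add0r.
have neqC i : (col i A != col j A) = (i != j) by rewrite (inj_eq col_inj).
symmetry; transitivity (\sum_(i | i != j) (col i A *+ k (col i A) +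
     (x i 0 *: col i A) *+ k (col j A))).
  apply: eq_bigr => i ij; rewrite neqC ij mulrnDr; congr (_ + _).
  rewrite (eq_bigl (pred1 i)) => [|i']; last exact: (inj_eq col_inj).
  rewrite big_pred1_eq mulnC mulrnA; congr (_ *+ _).
  by rewrite -scaler_nat natz gez0_abs.
rewrite big_split /= addrC; congr (_ + _).
rewrite sumrMnl; congr (_ *+ _).
by rewrite -Ax mulmx_sum_cols [RHS](bigD1 j) //= xj scale0r add0r.
Qed.

End CellNormal.

(** * Subdivision of cells by irreducible columns *)

Section LowDimension.
Variables (R : realType) (d n : nat) (A : 'M[int]_(d, n)).
Implicit Types (s : {set 'I_n}) (c : 'rV[int]_n) (b : 'cV[int]_d).
Local Notation toR := (map_mx (intr : int -> R)).
Local Notation AR := (toR A).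
Local Notation co s v := (coord R A s *m v).
Local Notation "'a_ j" := (toR (col j A)) (at level 8, j at level 2, format "''a_' j").

Lemma cone_coord s (v : 'cV[R]_d) :
  basis R A s -> nonneg (co s v) -> cone A v.
Proof. by move=> sb v0; exists (co s v); rewrite coordK. Qed.

Hypothesis posA : forall u : 'cV[R]_n, nonneg u -> AR *m u = 0 -> u = 0.
Hypothesis normalA : forall b, cone A (toR b) -> in_NA A b.
Hypothesis irrA : forall (x : 'cV[int]_n) j,
  nonneg x -> A *m x = col j A -> x = delta_mx j 0.

Lemma col_irr_inj i j : col i A = col j A -> i = j.
Proof.
rewrite (colE i) => /(irrA (@nonneg_delta _ _ i))/matrixP/(_ i 0).
by rewrite !mxE !eqxx andbT; case: eqP.
Qed.

(** The coefficient vectors of [u] and [v] add up to that of a single column. *)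
Lemma irreducible_sum j u v : in_NA A u -> in_NA A v ->
  u + v = col j A -> u = 0 \/ v = 0.
Proof.
move=> [x [x0 ->]] [x' [x'0 ->]]; rewrite -mulmxDr => /irrA e.
have {}e : x + x' = delta_mx j 0.
  by apply: e => k; rewrite mxE addr_ge0.
have eE k : x k 0 + x' k 0 = (k == j)%:R.
  by have /matrixP/(_ k 0) := e; rewrite !mxE andbT.
have [xj|xj] := ltP 0 (x j 0); [right|left].
  suff -> : x' = 0 by rewrite mulmx0.
  apply/matrixP => k i; rewrite ord1 [RHS]mxE; have := eE k; have := x0 k.
  by have := x'0 k; case: eqP => [->|_] /=; move: xj; lia.
suff -> : x = 0 by rewrite mulmx0.
apply/matrixP => k i; rewrite ord1 [RHS]mxE; have := eE k; have := x0 k.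
by have := x'0 k; case: eqP => [->|_] /=; move: xj; lia.
Qed.

Lemma col_neq0 j : col j A != 0.
Proof.
apply/eqP => e; have := real_col_neq0 posA j.
by rewrite e map_mx0 eqxx.
Qed.

(** A column in the cone of a basis, outside the basis, subdivides that cone;
each part has fewer columns in it, so the parallelepiped condition passes from
the parts without such columns to every basis. *)
Lemma cell_normal_of_parallelepiped :
  (forall s b, basis R A s -> b != 0 ->
     (forall j, 0 <= (co s (toR b)) j 0 < 1) ->
     exists2 m, m \notin s & nonneg (co s 'a_m)) ->
  forall s, basis R A s -> cell_normal R A s.
Proof.
move=> para s.
have [N] := ubnP #|[set j | `[< nonneg (co s 'a_j) >]]|.
elim: N s => // N IHN s ltN sb b bs.
have [[m [ms mc]]|nom] := pselect (exists m, m \notin s /\ nonneg (co s 'a_m)); last first.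
  pose fl : 'cV[int]_n := \col_j Num.floor ((co s (toR b)) j 0).
  have fl0 : nonneg fl by move=> j; rewrite mxE floor_ge0.
  have fls : supported s fl by move=> j js; rewrite mxE coord_supp // floor0.
  exists fl; split=> // [|j fj]; last first.
    have js : j \in s by apply: contraNT fj => /fls ->.
    by rewrite coord_vertex //; apply: nonneg_delta.
  apply/eqP; rewrite eq_sym -subr_eq0; apply: contraT => b'0; case: nom.
  have [|m ms mc] := para s _ sb b'0; last by exists m.
  move=> j; rewrite map_mxB mulmxBr map_mxM coord_col //; last first.
    by move=> k ks; rewrite mxE fls.
  rewrite !mxE subr_ge0 floor_le /= ltrBlDl.
  by have := floorD1_gt ((co s (toR b)) j 0); rewrite rmorphD /= !mxE.
pose mu := co s 'a_m; pose la := co s (toR b).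
have mum : mu m 0 = 0 by apply: coord_supp.
have [i0 mui0] : exists i, 0 < mu i 0.
  apply: contrapT => /forallNP mu_le; have := real_col_neq0 posA m.
  rewrite -(coordK 'a_m sb) -/mu (_ : mu = 0) ?mulmx0 ?eqxx //.
  apply/matrixP => k i; rewrite ord1 [RHS]mxE; apply/eqP; rewrite eq_le mc andbT.
  by rewrite leNgt; apply/negP.
have muE0 : co s 'a_m = mu by [].
have laE0 : co s (toR b) = la by [].
rewrite muE0 in mc; rewrite laE0 in bs.
clearbody mu la.
(* [i] is the first basis element that drops out when [a_m] is subtracted. *)
have [i mui imin] := @arg_minP _ R 'I_n i0 (fun k => 0 < mu k 0)
  (fun k => la k 0 / mu k 0) mui0.
have is_ : i \in s by apply: contraLR mui => ks; rewrite -muE0 coord_supp // ltxx.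
pose t := la i 0 / mu i 0.
have t0 : 0 <= t by apply: divr_ge0; [exact: bs|exact: ltW].
pose s' := m |: (s :\ i).
have im : i != m by apply: contraNneq ms => <-.
have dec (x : 'cV[R]_n) : supported s' x ->
    co s (AR *m x) = x m 0 *: (mu - delta_mx m 0) + x.
  move=> xs'; have {1}-> : x = x m 0 *: delta_mx m 0 + (x - x m 0 *: delta_mx m 0).
    by rewrite subrKC.
  rewrite mulmxDr mulmxDr -!scalemxAr -map_colE muE0 coord_col //.
    by rewrite scalerBr addrA addrAC.
  move=> k ks; rewrite !mxE andbT; case: eqP => [->|km]; first by rewrite mulr1 subrr.
  by rewrite mulr0 subr0 xs' // !inE (negPf ks) andbF orbF; apply/eqP.
have decE (x : 'cV[R]_n) k : supported s' x -> k != m ->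
    (co s (AR *m x)) k 0 = x m 0 * mu k 0 + x k 0.
  by move=> /dec -> km; rewrite !mxE (negPf km) subr0.
have s'i (x : 'cV[R]_n) : supported s' x -> x i 0 = 0.
  by apply; rewrite !inE eqxx (negPf im).
have s'b : basis R A s'.
  split=> [|x xs' Ax].
    by rewrite cardsU1 !inE (negPf ms) andbF -(proj1 sb) [RHS](cardsD1 i) is_.
  have xm : x m 0 = 0.
    have := decE x i xs' im; rewrite Ax mulmx0 mxE s'i // addr0 => /esym/eqP.
    by rewrite mulf_eq0 (gt_eqF mui) orbF => /eqP.
  by have := dec x xs'; rewrite Ax mulmx0 xm scale0r add0r => <-.
have inc v : nonneg (co s' v) -> nonneg (co s v).
  move=> v0 k; have := coordK v s'b => {1}<-.
  have [->|km] := eqVneq k m; first by rewrite coord_supp.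
  by rewrite decE //; [rewrite addr_ge0 // mulr_ge0 | exact: coord_supp].
have bs' : nonneg (co s' (toR b)).
  pose nu := t *: (delta_mx m 0 - mu) + la.
  have nus' : supported s' nu.
    move=> k; rewrite !inE negb_or negb_and negbK => /andP[km].
    have nuk : nu k 0 = la k 0 - t * mu k 0.
      by rewrite !mxE (negPf km) /= sub0r mulrN addrC.
    case/orP => [/eqP->|ks]; rewrite ?nuk; last first.
      by rewrite -laE0 -muE0 !coord_supp // mulr0 subr0.
    have -> : nu i 0 = la i 0 - t * mu i 0.
      by rewrite !mxE (negPf im) /= sub0r mulrN addrC.
    by rewrite /t divfK ?subrr // gt_eqF.
  have -> : toR b = AR *m nu.
    rewrite mulmxDr -scalemxAr mulmxBr -laE0 -muE0 !coordK // -map_colE subrr scaler0.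
    by rewrite add0r.
  rewrite coord_col // => k.
  have [->|km] := eqVneq k m.
    by rewrite !mxE !eqxx mum subr0 mulr1 addr_ge0 //; apply: bs.
  have -> : nu k 0 = la k 0 - t * mu k 0.
    by rewrite !mxE (negPf km) /= sub0r mulrN addrC.
  rewrite subr_ge0; have [muk|muk] := ltP 0 (mu k 0).
    by rewrite -ler_pdivlMr // imin.
  by rewrite (le_trans (mulr_ge0_le0 t0 muk)) //; apply: bs.
have not_inc : ~ nonneg (co s' 'a_i).
  move=> i0s'; pose x := co s' 'a_i.
  have xs' : supported s' x by apply: coord_supp.
  have e k : k != m -> (k == i)%:R = x m 0 * mu k 0 + x k 0.
    move=> km; rewrite -decE // coordK // coord_vertex //.
    by rewrite mxE andbT.
  have xm_gt0 : 0 < x m 0.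
    rewrite lt_neqAle i0s' andbT; apply/eqP => xm.
    by have /eqP := e i im; rewrite eqxx -xm mul0r add0r s'i // oner_eq0.
  have muE : mu = mu i 0 *: delta_mx i 0.
    apply/matrixP => k l; rewrite ord1 !mxE andbT {l}.
    have [->|ki] := eqVneq k i; first by rewrite mulr1.
    rewrite mulr0; have [->//|km] := eqVneq k m.
    have := e k km; rewrite (negPf ki) => /esym/eqP.
    rewrite paddr_eq0 ?(mulr_ge0 _ (mc k)) ?i0s' // mulf_eq0 gt_eqF //=.
    by case/andP => /eqP.
  have am : 'a_m = mu i 0 *: 'a_i.
    by rewrite -(coordK 'a_m sb) muE0 [in LHS]muE -scalemxAr -map_colE.
  have naj (j k : 'I_n) (a : R) : toR (col j A - col k A) = a *: 'a_i ->
      0 <= a -> in_NA A (col j A - col k A).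
    move=> e' a0; apply: normalA; exists (a *: delta_mx i 0); split.
      by move=> l; rewrite !mxE mulr_ge0 //; case: (_ && _).
    by rewrite e' -scalemxAr map_colE.
  have NAcol j : in_NA A (col j A) by apply/normalA/cone_col.
  suff /eqP : col i A = col m A by move=> /eqP/col_irr_inj/eqP; rewrite (negPf im).
  have [mu1|mu1] := leP (mu i 0) 1.
    have /(irreducible_sum (NAcol m)) : in_NA A (col i A - col m A).
      apply: (naj _ _ (1 - mu i 0)); last by rewrite subr_ge0.
      by rewrite map_mxB am scalerBl scale1r.
    move=> /(_ i); rewrite subrKC => /(_ erefl)[/eqP|/eqP].
      by rewrite (negPf (col_neq0 m)).
    by rewrite subr_eq0 => /eqP.
  have /(irreducible_sum (NAcol i)) : in_NA A (col m A - col i A).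
    apply: (naj _ _ (mu i 0 - 1)); last by rewrite subr_ge0 ltW.
    by rewrite map_mxB am scalerBl scale1r.
  move=> /(_ m); rewrite subrKC => /(_ erefl)[/eqP|/eqP].
    by rewrite (negPf (col_neq0 i)).
  by rewrite subr_eq0 => /eqP.
have [|x [x0 Ax xs']] := IHN s' _ s'b b bs'; last first.
  by exists x; split=> // j /xs'/inc.
rewrite -ltnS; apply: leq_trans ltN; rewrite ltnS; apply: proper_card; apply/properP; split.
  by apply/fintype.subsetP => j; rewrite !inE; apply: inc.
exists i; last by apply/negP => is_in; apply: not_inc; rewrite !inE in is_in.
by rewrite !inE coord_vertex //; apply: nonneg_delta.
Qed.

End LowDimension.

(** * Lattice points of parallelepipeds in dimension at most 3 *)

Section Parallelepipeds.
Variables (R : realType) (d n : nat) (A : 'M[int]_(d, n)).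
Implicit Types (s : {set 'I_n}) (c : 'rV[int]_n) (b : 'cV[int]_d).
Local Notation toR := (map_mx (intr : int -> R)).
Local Notation AR := (toR A).
Local Notation co s v := (coord R A s *m v).
Local Notation "'a_ j" := (toR (col j A)) (at level 8, j at level 2, format "''a_' j").

Hypothesis posA : forall u : 'cV[R]_n, nonneg u -> AR *m u = 0 -> u = 0.
Hypothesis normalA : forall b, cone A (toR b) -> in_NA A b.
Hypothesis irrA : forall (x : 'cV[int]_n) j,
  nonneg x -> A *m x = col j A -> x = delta_mx j 0.

Definition in_parallelepiped s b :=
  forall j, 0 <= (co s (toR b)) j 0 < 1.

Lemma coord_NA s b : basis R A s -> nonneg (co s (toR b)) -> in_NA A b.
Proof. by move=> sb b0; apply/normalA/(cone_coord sb). Qed.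

Lemma in_NA_add b b' : in_NA A b -> in_NA A b' -> in_NA A (b + b').
Proof.
move=> [x [x0 ->]] [x' [x'0 ->]]; exists (x + x'); rewrite mulmxDr; split=> // j.
by rewrite mxE addr_ge0.
Qed.

Lemma para_NA s b : basis R A s -> in_parallelepiped s b -> in_NA A b.
Proof. by move=> sb bp; apply: (coord_NA sb) => j; case/andP: (bp j). Qed.

Lemma coord_sum_cols s (t : {set 'I_n}) : basis R A s -> t \subset s ->
  co s (toR (\sum_(j in t) col j A)) = \col_j (j \in t)%:R.
Proof.
move=> sb ts; apply/matrixP => k i; rewrite ord1 {i} [RHS]mxE.
have -> : toR (\sum_(j in t) col j A) = \sum_(j in t) 'a_j.
  by apply/matrixP => a e; rewrite !mxE !summxE rmorph_sum; apply: eq_bigr => j _; rewrite !mxE.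
rewrite mulmx_sumr summxE (eq_bigr (fun j => (k == j)%:R)) => [|j jt]; last first.
  by rewrite coord_vertex ?(fintype.subsetP ts) // mxE andbT.
have [kt|kt] := boolP (k \in t).
  rewrite (bigD1 k) //= eqxx big1 ?addr0 // => j /andP[_ jk].
  by rewrite eq_sym (negPf jk).
by rewrite big1 // => j jt; case: eqP => // e; rewrite e jt in kt.
Qed.

(** A point [b] strictly between 0 and the basis vector would split this vector into
[b] and its complement. *)
Lemma parallelepiped1 : d = 1%N -> forall s b, basis R A s ->
  in_parallelepiped s b -> b = 0.
Proof.
move=> d1 s b sb bp; have /eqP/cards1P[i sE] : #|s| = 1%N by rewrite (proj1 sb).
have is_ : i \in s by rewrite sE inE.
have [la laE] : exists la, co s (toR b) = la by exists (co s (toR b)).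
have cE : co s (toR (col i A - b)) = delta_mx i 0 - la.
  by rewrite map_mxB mulmxBr coord_vertex // laE.
have c0 : nonneg (co s (toR (col i A - b))).
  move=> j; have := bp j; rewrite laE cE => /andP[lj0 /ltW lj1].
  rewrite !mxE andbT; have [_|ji] := eqVneq j i; first by rewrite subr_ge0.
  by rewrite -laE coord_supp ?subr0 // sE inE.
have := irreducible_sum irrA (para_NA sb bp) (coord_NA sb c0).
move=> /(_ i); rewrite subrKC => /(_ erefl)[//|/eqP]; rewrite subr_eq0 => /eqP e.
by have := bp i; rewrite -e coord_vertex // mxE !eqxx ltxx andbF.
Qed.

Section Planar.
Variable s : {set 'I_n}.
Variables i k : 'I_n.
Hypothesis sb : basis R A s.
Hypothesis sE : s = [set i; k].
Hypothesis ik : i != k.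

Lemma planar_eq (v v' : 'cV[R]_d) : (co s v) i 0 = (co s v') i 0 ->
  (co s v) k 0 = (co s v') k 0 -> v = v'.
Proof.
move=> ei ek; apply: (coord_inj sb); apply/matrixP => j l; rewrite ord1.
have [->//|ji] := eqVneq j i; have [->//|jk] := eqVneq j k.
by rewrite !coord_supp // sE !inE negb_or ji.
Qed.

Lemma planar_mem : (i \in s) * (k \in s).
Proof. by rewrite sE !inE !eqxx orbT. Qed.

(** The column [a_k] is the sum of [b - a_i] and of the reflection of [b] in the
centre of the parallelogram, which is in the cone; it is irreducible. *)
Lemma parallelogram_sub b : in_parallelepiped s b -> ~ in_NA A (b - col i A).
Proof.
move=> bp bi; pose r := col i A + col k A - b.
have [is_ ks] := planar_mem.
have [la laE] : exists la, co s (toR b) = la by exists (co s (toR b)).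
have rE : co s (toR r) = delta_mx i 0 + delta_mx k 0 - la.
  by rewrite map_mxB map_mxD mulmxBr mulmxDr !coord_vertex // laE.
have rNA : in_NA A r.
  apply: (coord_NA sb) => j; have := bp j; rewrite laE => /andP[lj0 /ltW lj1].
  have [js|js] := boolP (j \in s); last by rewrite coord_supp.
  rewrite rE !mxE !andbT subr_ge0 (le_trans lj1) //.
  move: js; rewrite sE !inE => /orP[]/eqP->; rewrite eqxx.
    by rewrite lerDl.
  by rewrite lerDr.
have := irreducible_sum irrA bi rNA; move=> /(_ k) [|/eqP|/eqP].
- by rewrite /r !addrA subrK addrC addKr.
- rewrite subr_eq0 => /eqP be; have := bp i.
  by rewrite be coord_vertex // mxE !eqxx ltxx andbF.
- rewrite subr_eq0 => /eqP be; have := bp i.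
  rewrite -be map_mxD mulmxDr !coord_vertex // !mxE !eqxx (negPf ik) addr0.
  by rewrite ltxx andbF.
Qed.

(** Otherwise [- a_m] would lie in the cone as well. *)
Lemma planar_not_both m : m \notin s ->
  (co s 'a_m) i 0 <= 0 -> 0 < (co s 'a_m) k 0.
Proof.
move=> ms mi; rewrite ltNge; apply/negP => mk.
have [mu muE] : exists mu, co s 'a_m = mu by exists (co s 'a_m).
rewrite muE in mi mk.
have mu_off j : j \notin s -> mu j 0 = 0 by move=> js; rewrite -muE coord_supp.
have : delta_mx m 0 - mu = 0.
  apply: posA => [j|]; last by rewrite -muE mulmxBr coordK // -map_colE subrr.
  rewrite !mxE andbT; have [js|js] := boolP (j \in s); last first.
    by rewrite mu_off // subr0 ler0n.
  have -> : (j == m) = false by apply: contraNF ms => /eqP <-.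
  by rewrite /= sub0r oppr_ge0; move: js; rewrite sE !inE => /orP[]/eqP->.
move=> /matrixP/(_ m 0); rewrite !mxE !eqxx mu_off // subr0 => /eqP.
by rewrite oner_eq0.
Qed.

(** The sign conditions make [a_i] a positive combination of [a_u] and [a_w]; by
irreducibility of [a_i] both coefficients are less than 1, so that
[a_u + a_w - a_i] is a positive combination as well. *)
Lemma planar_exchange u w : u \notin s -> w \notin s ->
  0 < (co s 'a_u) i 0 -> (co s 'a_u) k 0 < 0 ->
  (co s 'a_w) i 0 < 0 -> 0 < (co s 'a_w) k 0 ->
  in_NA A (col u A + col w A - col i A).
Proof.
move=> us ws; have [is_ ks] := planar_mem.
set ui := (co s 'a_u) i 0; set uk := (co s 'a_u) k 0.
set wi := (co s 'a_w) i 0; set wk := (co s 'a_w) k 0 => ui0 uk0 wi0 wk0.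
have uw : u != w by apply: contraTneq ui0 => e; rewrite /ui e -leNgt ltW.
pose ka := ui * wk - uk * wi.
have kaE : wk *: 'a_u - uk *: 'a_w = ka *: 'a_i.
  apply: planar_eq; rewrite !mulmx_linE (coord_vertex sb is_).
    by rewrite -/ui -/wi [X in _ = _ * X]mxE !eqxx mulr1 /ka mulrC.
  rewrite -/uk -/wk [X in _ = _ * X]mxE eq_sym (negPf ik) mulr0.
  by rewrite mulrC subrr.
have ka0 : 0 < ka.
  rewrite ltNge; apply/negP => ka0.
  have : wk *: delta_mx u 0 - uk *: delta_mx w 0 - ka *: delta_mx i 0 = 0 :> 'cV[R]_n.
    apply: posA => [j|].
      rewrite !mxE -!mulNr !addr_ge0 // mulr_ge0 ?ler0n ?oppr_ge0 //; exact: ltW.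
    by rewrite !mulmxBr -!scalemxAr -!map_colE kaE subrr.
  move=> /matrixP/(_ u 0); rewrite !mxE !eqxx (negPf uw) /=.
  have -> : (u == i) = false by apply: contraNF us => /eqP ->.
  by rewrite !mulr0 !subr0 mulr1 => wk_0; rewrite wk_0 ltxx in wk0.
have aiE : 'a_i = (wk / ka) *: 'a_u + (- uk / ka) *: 'a_w.
  have -> : 'a_i = ka^-1 *: (wk *: 'a_u - uk *: 'a_w).
    by rewrite kaE scalerA mulVf ?scale1r // lt0r_neq0.
  by rewrite scalerBr !scalerA ![ka^-1 * _]mulrC mulNr scaleNr.
have al0 : 0 < wk / ka by rewrite divr_gt0.
have be0 : 0 < - uk / ka by rewrite divr_gt0 ?oppr_gt0.
move: (wk / ka) (- uk / ka) al0 be0 aiE => al be al0 be0 aiE.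
have inC (x y : R) b : 0 <= x -> 0 <= y -> toR b = x *: 'a_u + y *: 'a_w -> in_NA A b.
  move=> x0 y0 bE; apply: normalA; rewrite bE.
  exists (x *: delta_mx u 0 + y *: delta_mx w 0); split.
    by move=> j; rewrite !mxE addr_ge0 // mulr_ge0 // ler0n.
  by rewrite mulmxDr -!scalemxAr -!map_colE.
have NAcol j : in_NA A (col j A) by apply/normalA/cone_col.
have no_split m : m \notin s -> ~ in_NA A (col i A - col m A).
  move=> ms NAd; have := irreducible_sum (j := i) irrA (NAcol m) NAd.
  rewrite subrKC => /(_ erefl)[/eqP|/eqP]; first by rewrite (negPf (col_neq0 posA m)).
  rewrite subr_eq0 => /eqP/(col_irr_inj irrA) im.
  by rewrite -im is_ in ms.
have al1 : al < 1.
  rewrite ltNge; apply/negP => al1; apply: (no_split u us).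
  apply: (inC (al - 1) be); rewrite ?subr_ge0 ?(ltW be0) //.
  by rewrite map_mxB aiE scalerBl scale1r addrAC.
have be1 : be < 1.
  rewrite ltNge; apply/negP => be1; apply: (no_split w ws).
  apply: (inC al (be - 1)); rewrite ?subr_ge0 ?(ltW al0) //.
  by rewrite map_mxB aiE scalerBl scale1r addrA.
apply: (inC (1 - al) (1 - be)); rewrite ?subr_ge0 ?(ltW al1) ?(ltW be1) //.
by rewrite map_mxB map_mxD aiE !scalerBl !scale1r opprD addrACA.
Qed.

End Planar.

(** If no further column is in the cone, a decomposition of [b] into columns cannot
use [a_i] or [a_k], by [parallelogram_sub], so it uses columns on both sides of
the cone; [planar_exchange] then trades two of them for [a_i]. *)
Lemma parallelepiped2 : d = 2%N -> forall s b, basis R A s -> b != 0 ->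
  in_parallelepiped s b -> exists2 m, m \notin s & nonneg (co s 'a_m).
Proof.
move=> d2 s b sb b0 bp; have /eqP/cards2P[i [k [ik sE]]] : #|s| = 2%N by rewrite (proj1 sb).
have ki : k != i by rewrite eq_sym.
have sE' : s = [set k; i] by rewrite sE finset.setUC.
have no_i := parallelogram_sub sb sE ik bp.
have no_k := parallelogram_sub sb sE' ki bp.
apply: contrapT => nom.
have [x [x0 bE]] := para_NA sb bp.
have subx (y : 'cV[int]_n) : nonneg y -> (forall j, y j 0 <= x j 0) -> in_NA A (b - A *m y).
  move=> y0 yx; exists (x - y); rewrite mulmxBr -bE; split=> // j.
  by rewrite !mxE subr_ge0.
have x_vanish j : ~ in_NA A (b - col j A) -> x j 0 = 0.
  move=> noj; apply/eqP; rewrite eq_le x0 andbT -ltzD1 add0r ltNge; apply/negP => xj.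
  apply: noj; rewrite colE; apply: subx => [|l]; first exact: nonneg_delta.
  by rewrite mxE andbT; case: eqP => [->|_] //; apply: x0.
have xs j : x j 0 != 0 -> j \notin s.
  move=> xj; apply/negP; rewrite sE !inE => /orP[]/eqP e.
    by rewrite e x_vanish ?eqxx in xj.
  by rewrite e x_vanish ?eqxx in xj.
have coE l : (co s (toR b)) l 0 = \sum_j (x j 0)%:~R * (co s 'a_j) l 0.
  rewrite bE map_mxM mulmxA mxE; apply: eq_bigr => j _.
  by rewrite coord_mulE [toR x j 0]mxE mulrC.
have side i' k' : s = [set i'; k'] -> i' != k' ->
    exists u, [/\ x u 0 != 0, 0 < (co s 'a_u) i' 0 & (co s 'a_u) k' 0 < 0].
  move=> sE1 ik1; apply: contrapT => none.
  have le0 j : x j 0 != 0 -> (co s 'a_j) i' 0 < 0.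
    move=> xj; rewrite ltNge; apply/negP => ji.
    have jk : (co s 'a_j) k' 0 < 0.
      rewrite ltNge; apply/negP => jk; apply: nom; exists j; first exact: xs.
      move=> l; have [ls|ls] := boolP (l \in s); last by rewrite coord_supp.
      by move: ls; rewrite {1}sE1 !inE => /orP[]/eqP->.
    apply: none; exists j; split=> //; rewrite lt_neqAle ji andbT eq_sym.
    apply/eqP => ji0; have := planar_not_both sb sE1 (xs j xj).
    by rewrite ji0 lexx => /(_ isT); rewrite ltNge (ltW jk).
  have t0 j : true -> 0 <= - ((x j 0)%:~R * (co s 'a_j) i' 0).
    move=> _; have [->|xj] := eqVneq (x j 0) 0; first by rewrite mul0r oppr0.
    by rewrite oppr_ge0 mulr_ge0_le0 ?ler0z // ltW // le0.
  have : \sum_j - ((x j 0)%:~R * (co s 'a_j) i' 0) = 0.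
    apply/eqP; rewrite eq_le sumr_ge0 // andbT sumrN oppr_le0 -coE.
    by case/andP: (bp i').
  move=> /(psumr_eq0P t0) xz; case/negP: b0; rewrite bE; apply/eqP.
  suff -> : x = 0 by rewrite mulmx0.
  apply/matrixP => j l; rewrite ord1 [RHS]mxE; apply/eqP; apply: contraT => xj.
  have /eqP := xz j isT; rewrite oppr_eq0 mulf_eq0 intr_eq0 (negPf xj) /=.
  by rewrite lt_eqF // le0.
have [u [xu ui uk]] := side i k sE ik.
have [w [xw wk wi]] := side k i sE' ki.
apply: no_i.
have uwx : in_NA A (b - A *m (delta_mx u 0 + delta_mx w 0)).
  apply: subx => j; rewrite !mxE; first by rewrite addr_ge0 ?ler0n.
  have uw : u != w by apply: contraTneq ui => ->; rewrite -leNgt ltW.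
  rewrite !andbT; have [->|ju] := eqVneq j u.
    by rewrite (negPf uw) addr0 -gtz0_ge1 lt0r xu x0.
  by have [->|jw] := eqVneq j w; rewrite add0r ?x0 // -gtz0_ge1 lt0r xw x0.
have := in_NA_add uwx (planar_exchange sb sE ik (xs u xu) (xs w xw) ui uk wi wk).
by rewrite mulmxDr -!colE addrA subrK.
Qed.

Section Graded.
Variable h : 'rV[R]_d.
Hypothesis hA : forall j, (h *m AR) 0 j = 1.

Lemma height_sum (x : 'cV[R]_n) : (h *m (AR *m x)) 0 0 = \sum_j x j 0.
Proof. by rewrite mulmxA mxE; apply: eq_bigr => j _; rewrite hA mul1r. Qed.

(** The height of a combination of columns is the sum of its coefficients. *)
Lemma height_one b : in_NA A b -> (h *m toR b) 0 0 = 1 -> exists m, b = col m A.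
Proof.
move=> [x [x0 ->]]; rewrite map_mxM height_sum => e.
have {}e : \sum_j x j 0 = 1.
  apply/eqP; rewrite -(eqr_int R) -[X in _ == X]e rmorph_sum; apply/eqP.
  by apply: eq_bigr => j _; rewrite mxE.
have [m xm] : exists m, x m 0 != 0.
  apply: contrapT => /forallNP none; move: e; rewrite big1 // => j _.
  by apply/eqP; apply: contraT => /(none j).
exists m; rewrite colE; congr (_ *m _).
have rest0 : 0 <= \sum_(j | j != m) x j 0 by apply: sumr_ge0.
have [xm1 rest] : x m 0 = 1 /\ \sum_(j | j != m) x j 0 = 0.
  have : 0 < x m 0 by rewrite lt0r xm x0.
  by move: e; rewrite (bigD1 m) //=; move: (\sum_(_ | _) _) rest0 => r; lia.
apply/matrixP => j l; rewrite ord1 mxE andbT.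
have [->//|jm] := eqVneq j m; exact: (psumr_eq0P (fun j _ => x0 j) rest).
Qed.

Lemma parallelepiped_height s b : (0 < d)%N -> basis R A s -> b != 0 ->
  in_parallelepiped s b ->
  exists k : nat, [/\ (h *m toR b) 0 0 = k%:R, (0 < k)%N & (k < d)%N].
Proof.
move=> d0 sb b0 bp; have [x [x0 bE]] := para_NA sb bp.
have hx : (h *m toR b) 0 0 = (\sum_j x j 0)%:~R.
  by rewrite bE map_mxM height_sum rmorph_sum; apply: eq_bigr => j _; rewrite mxE.
have X0 : 0 <= \sum_j x j 0 by apply: sumr_ge0.
exists (absz (\sum_j x j 0)); split; first by rewrite hx natr_absz ger0_norm.
  rewrite absz_gt0; apply: contra b0 => /eqP X_0; rewrite bE.
  suff -> : x = 0 by rewrite mulmx0.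
  by apply/matrixP => j l; rewrite ord1 mxE; apply: (psumr_eq0P (fun j _ => x0 j) X_0).
rewrite -(ltr_nat R) natr_absz ger0_norm // -hx -(coordK (toR b) sb) height_sum.
have -> : d%:R = \sum_(j in s) 1 :> R by rewrite sumr_const (proj1 sb).
rewrite (bigID (mem s)) /= [X in _ + X]big1 ?addr0.
  apply: ltr_sum => [|j _]; last by case/andP: (bp j).
  have : (0 < #|s|)%N by rewrite (proj1 sb).
  by case/card_gt0P => j js; apply/hasP; exists j; rewrite ?mem_index_enum.
by move=> j js; rewrite coord_supp.
Qed.

(** Heights of the points considered are integers strictly between 0 and 2. *)
Lemma parallelogram_col : d = 2%N -> forall s b, basis R A s -> b != 0 ->
  in_parallelepiped s b -> exists m, b = col m A.
Proof.
move=> d2 s b sb b0 bp; have d0 : (0 < d)%N by rewrite d2.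
have [k [hk k0 kd]] := parallelepiped_height d0 sb b0 bp.
apply: (height_one (para_NA sb bp)); rewrite hk.
by have -> : k = 1%N by move: k0 kd; rewrite d2; lia.
Qed.

(** At height 2 the reflection in the centre has height 1. *)
Lemma parallelepiped3 : d = 3%N -> forall s b, basis R A s -> b != 0 ->
  in_parallelepiped s b -> exists2 m, m \notin s & nonneg (co s 'a_m).
Proof.
move=> d3 s b sb b0 bp; have d0 : (0 < d)%N by rewrite d3.
have [k [hk k0 kd]] := parallelepiped_height d0 sb b0 bp.
have [k1|k2] : k = 1%N \/ k = 2%N by move: k0 kd; rewrite d3; lia.
  have [|m bm] := height_one (para_NA sb bp); first by rewrite hk k1.
  exists m; last by move=> j; rewrite -bm; case/andP: (bp j).
  apply/negP => ms; have /andP[_] := bp m.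
  by rewrite bm coord_vertex // mxE !eqxx ltxx.
pose r := \sum_(j in s) col j A - b.
have rE j : (co s (toR r)) j 0 = (j \in s)%:R - (co s (toR b)) j 0.
  rewrite map_mxB mulmxBr coord_sum_cols //.
  by rewrite mxE [X in _ + X]mxE [X in X - _]mxE.
have r0 : nonneg (co s (toR r)).
  move=> j; rewrite rE; have /andP[_ /ltW bj] := bp j.
  by have [js|js] := boolP (j \in s); rewrite ?subr_ge0 // coord_supp // subr0.
have hr : (h *m toR r) 0 0 = 1.
  rewrite map_mxB mulmxBr mxE [X in _ + X]mxE hk k2.
  rewrite -(coordK (toR (\sum_(j in s) _)) sb) height_sum coord_sum_cols //.
  have -> : \sum_j (\col_j (j \in s)%:R : 'cV[R]_n) j 0 = \sum_(j in s) 1.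
    by rewrite [RHS]big_mkcond; apply: eq_bigr => j _; rewrite mxE; case: (_ \in _).
  by rewrite sumr_const (proj1 sb) d3 mulrSr addrC addKr.
have [m rm] := height_one (coord_NA sb r0) hr.
exists m; last by rewrite -rm.
apply/negP => ms.
have : (0 < #|s :\ m|)%N.
  have : (1 + #|s :\ m| = 3)%N by rewrite -d3 -(proj1 sb) (cardsD1 m s) ms.
  by case: #|_|.
case/card_gt0P => l; rewrite !inE => /andP[lm ls].
have /eqP := rE l; rewrite rm coord_vertex // mxE (negPf lm) ls /= eq_sym subr_eq0.
by have /andP[_ bl] := bp l => /eqP e; rewrite -e ltxx in bl.
Qed.

End Graded.
End Parallelepipeds.

(** * Uniqueness in the planar graded case *)

Section Translation.
Variables (d n : nat) (A : 'M[int]_(d, n)) (c : 'rV[int]_n).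

Lemma costD x x' : cost c (x + x') = cost c x + cost c x'.
Proof. by rewrite /cost mulmxDr mxE. Qed.

Lemma costB x x' : cost c (x - x') = cost c x - cost c x'.
Proof. by rewrite /cost mulmxDr mulmxN !mxE. Qed.

Lemma cost_delta j : cost c (delta_mx j 0) = c 0 j.
Proof. by rewrite /cost sum_delta. Qed.

Lemma gfeasD s (b : 'cV[int]_d) x f : supported s f ->
  gfeas A s b x -> gfeas A s (b + A *m f) (x + f).
Proof.
move=> fs [<- x0]; split=> [|j js]; first by rewrite mulmxDr.
by rewrite mxE fs // addr0 x0.
Qed.

Lemma supportedN s (f : 'cV[int]_n) : supported s f -> supported s (- f).
Proof. by move=> fs j js; rewrite mxE fs // oppr0. Qed.

Lemma supportedB s (f g : 'cV[int]_n) :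
  supported s f -> supported s g -> supported s (f - g).
Proof. by move=> fs gs j js; rewrite !mxE fs // gs // subr0. Qed.

Lemma goptD s (b : 'cV[int]_d) x f : supported s f ->
  gopt A c s b x -> gopt A c s (b + A *m f) (x + f).
Proof.
move=> fs [xf xmin]; split=> [|x' /(gfeasD (supportedN fs))]; first exact: gfeasD.
by rewrite mulmxN addrK => /xmin; rewrite costB costD lerBrDr.
Qed.

End Translation.

Section Uniqueness.
Variables (R : realType) (d n : nat) (A : 'M[int]_(d, n)).
Implicit Types (s : {set 'I_n}) (b : 'cV[int]_d).
Local Notation toR := (map_mx (intr : int -> R)).
Local Notation AR := (toR A).
Local Notation co s v := (coord R A s *m v).
Local Notation "'a_ j" := (toR (col j A)) (at level 8, j at level 2, format "''a_' j").

Hypothesis rkA : \rank AR = d.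
Hypothesis posA : forall u : 'cV[R]_n, nonneg u -> AR *m u = 0 -> u = 0.
Hypothesis normalA : forall b, cone A (toR b) -> in_NA A b.
Hypothesis irrA : forall (x : 'cV[int]_n) j,
  nonneg x -> A *m x = col j A -> x = delta_mx j 0.
Hypothesis d2 : d = 2%N.
Variable h : 'rV[R]_d.
Hypothesis hA : forall j, (h *m AR) 0 j = 1.

Definition inside s m := m \notin s /\ forall k, k \in s -> 0 < (co s 'a_m) k 0.

Lemma inside_nonneg s m : inside s m -> nonneg (co s 'a_m).
Proof.
move=> [_ m_gt0] k; have [/m_gt0/ltW//|ks] := boolP (k \in s).
by rewrite coord_supp.
Qed.

(** Modulo the lattice of the basis [s], a lattice point is 0 or a column
inside the cone: the only lattice points of the half-open parallelogram are of
height 0 or 1. *)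
Lemma residue s b : basis R A s -> exists f : 'cV[int]_n,
  [/\ supported s f, nonneg (co s (toR b)) -> nonneg f &
      b = 0 + A *m f \/ exists2 m, inside s m & b = col m A + A *m f].
Proof.
move=> sb; pose f : 'cV[int]_n := \col_j Num.floor ((co s (toR b)) j 0).
have fs : supported s f by move=> j js; rewrite mxE coord_supp // floor0.
exists f; split=> //; first by move=> b0 j; rewrite mxE floor_ge0.
pose r := b - A *m f.
have -> : b = r + A *m f by rewrite subrK.
have [->|r0] := eqVneq r 0; [by left | right].
have rp : in_parallelepiped R A s r.
  move=> j; rewrite map_mxB mulmxBr map_mxM coord_col //; last first.
    by move=> k ks; rewrite mxE fs.
  rewrite !mxE subr_ge0 floor_le /= ltrBlDl.
  by have := floorD1_gt ((co s (toR b)) j 0); rewrite rmorphD /= !mxE.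
have [m rm] := parallelogram_col normalA hA d2 sb r0 rp.
exists m; last by rewrite rm.
rewrite /in_parallelepiped rm in rp.
split=> [|k ks].
  by apply/negP => ms; have := rp m; rewrite coord_vertex // mxE !eqxx ltxx andbF.
have [lak _] := andP (rp k); rewrite lt_neqAle lak andbT eq_sym; apply/eqP => k0.
have /eqP/cards2P[i [l [il sE]]] : #|s| = 2%N by rewrite (proj1 sb).
have [o [ok os sE']] : exists o, [/\ o != k, o \in s & s = [set k; o]].
  move: (ks); rewrite {1}sE !inE => /orP[]/eqP->.
    by exists l; split; rewrite // 1?eq_sym // sE !inE eqxx orbT.
  by exists i; split; rewrite // sE ?inE ?eqxx // finset.setUC.
have := height_sum hA (co s 'a_m); rewrite coordK // dot_colE hA.
rewrite (bigD1 k) //= k0 add0r (bigD1 o) //= big1 ?addr0 => [e|j].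
  by have := rp o; rewrite -e ltxx andbF.
by rewrite -negb_or => jko; rewrite coord_supp // sE' !inE.
Qed.

Section GomoryFamily.
Variable c : 'rV[int]_n.
Hypothesis face_indep : forall s, faces R A c s -> indep R A s.
Hypothesis gomory : gomory_family R A c.
Local Notation MF s := (maximal_face (faces R A c) s).
Local Notation vx s := (vertex R A c s).

Let reduced s j : R := (c 0 j)%:~R - (vx s *m AR) 0 j.

Lemma cost_supported s f : MF s -> supported s f ->
  (cost c f)%:~R = (vx s *m toR (A *m f)) 0 0 :> R.
Proof.
move=> sm fs; have [dy ty] := vertex_dual rkA face_indep sm.
rewrite costE map_mxM (@tight_duality _ _ _ _ c) //.
by move=> j js; rewrite mxE fs // -ty.
Qed.

Definition non_vertex t := forall s, MF s -> t \notin s.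

Lemma inside_non_vertex s m : MF s -> inside s m -> non_vertex m.
Proof.
move=> sm mi s' s'm; apply/negP => ms'.
have := coord_agree_vertex rkA face_indep s'm sm ms' (inside_nonneg mi).
by rewrite (negPf (proj1 mi)).
Qed.

Lemma inside_same_cell s s' m : MF s -> MF s' -> inside s m ->
  nonneg (co s' 'a_m) -> s' = s.
Proof.
move=> sm s'm mi m0; have mE := coord_agree rkA face_indep sm s'm (inside_nonneg mi) m0.
apply: (proj2 sm) (proj1 s'm) _; apply/fintype.subsetP => k ks.
apply: contraT => ks'; have := proj2 mi k ks.
by rewrite -mE coord_supp // ltxx.
Qed.

(** A column that is not a vertex is the only solution of its own program, so
it is optimal for the group relaxation at some cell; its residue there is a
column inside that cell, of reduced cost at least as large. *)
Lemma non_vertex_residue t : non_vertex t -> exists s m f,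
  [/\ MF s, unique (gopt A c s (col t A)) (delta_mx t 0), supported s f,
      inside s m & col t A = col m A + A *m f].
Proof.
move=> tn; have tNA : in_NA A (col t A) by apply/normalA/cone_col.
have [s [sm /(group_solvesE rkA face_indep _ sm)[x [xo x0]]]] := gomory tNA.
have xE : x = delta_mx t 0 by apply: irrA => //; case: xo => -[[]].
rewrite xE in xo; have sb := mf_basis rkA face_indep sm.
have [f [fs _ [e|[m mi e]]]] := residue (col t A) sb; last by exists s, m, f.
have [[_ tmin] _] := xo.
have : gfeas A s (col t A) f.
  by split=> [|j js]; rewrite ?fs // e add0r.
move=> /tmin; rewrite cost_delta -(ler_int R) (cost_supported sm fs).
rewrite -[A *m f]add0r -e dot_colE leNgt => /negP; case.
exact: (vertex_lt rkA face_indep sm (tn s sm)).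
Qed.

Lemma residue_reduced_le s t m f : MF s -> gopt A c s (col t A) (delta_mx t 0) ->
  supported s f -> col t A = col m A + A *m f ->
  gfeas A s (col t A) (delta_mx m 0 + f) /\ reduced s t <= reduced s m.
Proof.
move=> sm [_ tmin] fs e.
have mf : gfeas A s (col t A) (delta_mx m 0 + f).
  by rewrite e; apply: gfeasD => //; split=> [|j _]; [rewrite colE | apply: nonneg_delta].
split=> //; have := tmin _ mf; rewrite costD !cost_delta -(ler_int R) rmorphD /=.
rewrite (cost_supported sm fs) /reduced.
have -> : (vx s *m toR (A *m f)) 0 0 = (vx s *m AR) 0 t - (vx s *m AR) 0 m.
  by rewrite -!(dot_colE A (vx s)) e map_mxD mulmx_linE addrC addKr.
by lra.
Qed.

(** The assignment of residues is an injective self-map of the columns that are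
not vertices, along which the excess of the cost over the lower envelope does
not decrease.  Summing over all of them, nothing increases, and by uniqueness
of the group optimum every column is its own residue. *)
Lemma non_vertex_own_cell t : non_vertex t ->
  exists s, [/\ MF s, inside s t & gopt A c s (col t A) (delta_mx t 0)].
Proof.
pose P (t : 'I_n) (q : {set 'I_n} * 'I_n * 'cV[int]_n) :=
  [/\ MF q.1.1, unique (gopt A c q.1.1 (col t A)) (delta_mx t 0),
      supported q.1.1 q.2, inside q.1.1 q.1.2 & col t A = col q.1.2 A + A *m q.2].
have Pex u : exists q, non_vertex u -> P u q.
  have [un|un] := pselect (non_vertex u); last by exists (finset.set0, u, 0) => /un.
  by have [s [m [f Pu]]] := non_vertex_residue un; exists (s, m, f).
pose q u := sval (cid (Pex u)).
have qP u : non_vertex u -> P u (q u) by exact: svalP (cid (Pex u)).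
pose rho u := (q u).1.2; pose tau u := (q u).1.1; pose fl u := (q u).2.
pose N := [set u | `[< non_vertex u >]].
have NE u : (u \in N) <-> non_vertex u by rewrite inE; split=> /asboolP.
have rhoN u : u \in N -> rho u \in N.
  move=> /NE/qP[sm _ _ mi _]; apply/NE; exact: inside_non_vertex mi.
have cellP j := cid2 (cone_cover rkA posA face_indep (cone_col R A j)).
pose cell j := s2val (cellP j).
have cell_max j : MF (cell j) by exact: s2valP (cellP j).
have cell_col j : nonneg (co (cell j) 'a_j) by exact: s2valP' (cellP j).
have cell_best s j : MF s -> (vx s *m AR) 0 j <= (vx (cell j) *m AR) 0 j.
  move=> sm; rewrite -[leLHS]dot_colE -[leRHS]dot_colE.
  apply: (dual_le_vertex rkA face_indep) => //.
  by have [] := vertex_dual rkA face_indep sm.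
pose excess j := reduced (cell j) j.
have excess_le s j : MF s -> excess j <= reduced s j.
  by move=> sm; rewrite lerD2l lerN2 cell_best.
have excess_in s j : MF s -> nonneg (co s 'a_j) -> reduced s j <= excess j.
  move=> sm sj; rewrite lerD2l lerN2 -[leLHS]dot_colE -[leRHS]dot_colE.
  apply: (dual_le_vertex rkA face_indep) => //.
  by have [] := vertex_dual rkA face_indep (cell_max j).
have red_le u : u \in N -> reduced (tau u) u <= reduced (tau u) (rho u).
  by move=> /NE/qP[sm [uo _] fs mi e]; have [] := residue_reduced_le sm uo fs e.
have ex_rho u : u \in N -> reduced (tau u) (rho u) <= excess (rho u).
  by move=> /NE/qP[sm _ _ mi _]; apply: excess_in => //; apply: inside_nonneg.
have rho_le u : u \in N -> excess u <= excess (rho u).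
  move=> uN; have [sm _ _ _ _] := qP u (proj1 (NE u) uN).
  by apply: le_trans (excess_le _ _ sm) (le_trans (red_le u uN) (ex_rho u uN)).
have rho_inj : {in N &, injective rho}.
  move=> u u' /NE un /NE u'n ee; have [sm [uo uu] fs mi e] := qP u un.
  have [s'm [u'o u'u] f's m'i e'] := qP u' u'n.
  rewrite -!/(rho _) -!/(tau _) -!/(fl _) in sm uo uu fs mi e s'm u'o u'u f's m'i e'.
  have ts : tau u' = tau u.
    by apply: (inside_same_cell sm s'm mi); rewrite ee; apply: inside_nonneg.
  rewrite ts in s'm u'o u'u f's m'i.
  have col_u : col u A = col u' A + A *m (fl u - fl u').
    by rewrite e e' ee mulmxBr -addrA subrKC.
  have o' := goptD (supportedB fs f's) u'o; rewrite -col_u in o'.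
  have /matrixP/(_ u 0) := uu _ o'.
  rewrite !mxE fs ?f's ?(un _ sm) // subrr addr0 !eqxx andbT.
  by case: eqP => // _ /eqP; rewrite oner_eq0.
have sum_rho : \sum_(u in N) excess (rho u) = \sum_(u in N) excess u.
  have -> : \sum_(u in N) excess u = \sum_(u in rho @: N) excess u.
    apply: eq_bigl; suff -> : rho @: N = N by [].
    apply/eqP; rewrite eqEcard card_in_imset // leqnn andbT.
    by apply/fintype.subsetP => _ /imsetP[u uN ->]; apply: rhoN.
  by rewrite big_imset.
move=> /NE tN; have [sm [to tu] fs mi e] := qP t (proj1 (NE t) tN).
have t_eq : excess (rho t) - excess t = 0.
  have t0 u : u \in N -> 0 <= excess (rho u) - excess u.
    by move=> uN; rewrite subr_ge0 rho_le.
  by apply: (psumr_eq0P t0) => //; rewrite sumrB sum_rho subrr.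
have [mf _] := residue_reduced_le sm to fs e.
have mo : gopt A c (tau t) (col t A) (delta_mx (rho t) 0 + fl t).
  split=> // x' x'f; apply: le_trans (proj2 to _ x'f).
  rewrite costD !cost_delta -(ler_int R) rmorphD /= (cost_supported sm fs).
  have -> : (vx (tau t) *m toR (A *m fl t)) 0 0 =
            (vx (tau t) *m AR) 0 t - (vx (tau t) *m AR) 0 (rho t).
    by rewrite -!(dot_colE A (vx (tau t))) e map_mxD mulmx_linE addrC addKr.
  have := ex_rho t tN; have := excess_le _ t sm; rewrite /reduced; move: t_eq.
  by rewrite -/(tau t); lra.
have rt : rho t = t.
  have /matrixP/(_ t 0) := tu _ mo.
  rewrite !mxE fs ?(proj1 (NE t) tN _ sm) // addr0 !eqxx andbT.
  by case: eqP => // _ /eqP; rewrite oner_eq0.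
by exists (tau t); split=> //; move: mi; rewrite -/(rho t) rt.
Qed.

Lemma normal_form_vertex s f : MF s -> supported s f -> gopt A c s (0 + A *m f) (0 + f).
Proof.
move=> sm fs; have [dy ty] := vertex_dual rkA face_indep sm.
apply: goptD => //; split; first by split=> [|j _]; rewrite ?mulmx0 ?mxE.
move=> x [Ax x0]; rewrite -(ler_int R) !costE map_mx0 mulmx0.
have x_off j : j \notin tight A c (vx s) -> 0 <= toR x j 0.
  by rewrite ty mxE ler0z; apply: x0.
by have := weak_duality dy x_off; rewrite -map_mxM Ax map_mx0 mulmx0.
Qed.

(** Group optimality at [s] is invariant under translations along [s]. *)
Lemma normal_form_inside s f m : MF s -> supported s f -> inside s m ->
  gopt A c s (col m A + A *m f) (delta_mx m 0 + f).
Proof.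
move=> sm fs mi; apply: goptD => //.
have [s' [s'm mi' o]] := non_vertex_own_cell (inside_non_vertex sm mi).
by rewrite -(inside_same_cell sm s'm mi (inside_nonneg mi')).
Qed.

End GomoryFamily.

Lemma gopt_nonneg_optimal c s b x :
  gopt A c s b x -> nonneg x -> optimal A c b x.
Proof.
move=> [[Ax _] xmin] x0; split=> // x' [Ax' x'0]; apply: xmin.
by split.
Qed.

(** The normal form modulo the cell is a non-negative group optimum for either cost
vector, and it depends on the triangulation only. *)
Lemma supports_optimal c c' Delta b x :
  supports R A Delta c -> supports R A Delta c' ->
  in_NA A b -> optimal A c b x -> optimal A c' b x.
Proof.
move=> [cgen cD cG] [c'gen c'D c'G] bNA xo.
have cind s : faces R A c s -> indep R A s by apply: generic_indep.
have c'ind s : faces R A c' s -> indep R A s by apply: generic_indep.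
have [s sm bs] := cone_cover rkA posA cind (cone_NA R bNA).
have sm' : maximal_face (faces R A c') s by rewrite -c'D cD.
have sb := mf_basis rkA cind sm.
suff [z [z0 zo zo']] : exists z, [/\ nonneg z, gopt A c s b z & gopt A c' s b z].
  have [x1 [_ x1u]] := cgen b bNA.
  rewrite -(x1u _ xo) (x1u _ (gopt_nonneg_optimal zo z0)).
  exact: gopt_nonneg_optimal zo' z0.
have [f [fs f0 [->|[m mi ->]]]] := residue b sb.
  exists (0 + f); split; first by rewrite add0r; apply: f0.
    exact: normal_form_vertex.
  exact: normal_form_vertex.
exists (delta_mx m 0 + f); split.
- by move=> j; rewrite mxE addr_ge0 ?f0 //; apply: nonneg_delta.
- exact: normal_form_inside.
- exact: normal_form_inside.
Qed.

Lemma supports_opt_solutions c c' Delta :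
  supports R A Delta c -> supports R A Delta c' ->
  opt_solutions A c = opt_solutions A c'.
Proof.
move=> cS c'S; apply/funext => x; apply/propext; split=> -[b [bNA xo]].
  by exists b; split=> //; apply: supports_optimal cS c'S bNA xo.
by exists b; split=> //; apply: supports_optimal c'S cS bNA xo.
Qed.

End Uniqueness.

(** * A criterion against Gomory families *)

Section Criteria.
Variables (R : realType) (d n : nat) (A : 'M[int]_(d, n)).
Local Notation toR := (map_mx (intr : int -> R)).
Local Notation AR := (toR A).

(** If [v] and [- v] have coefficient vectors [u] and [u'], then [u + u'] is in the
kernel. *)
Lemma pointed_cone :
  (forall u : 'cV[R]_n, nonneg u -> AR *m u = 0 -> u = 0) ->
  pointed (@cone R d n A).
Proof.
move=> posA v [u [u0 vE]] [u' [u'0 vE']].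
have /posA : nonneg (u + u') by move=> j; rewrite mxE addr_ge0.
rewrite mulmxDr -vE -vE' subrr => /(_ erefl)/matrixP uu.
rewrite vE; suff -> : u = 0 by rewrite mulmx0.
apply/matrixP => j i; rewrite ord1 [RHS]mxE; apply/eqP.
have := uu j 0; rewrite !mxE => /eqP; rewrite paddr_eq0 ?u0 ?u'0 //.
by case/andP.
Qed.

(** Irreducibility is minimality: a generating subset that misses a column would
express this column by others. *)
Lemma minimal_hilbert_basis_cols :
  (forall b : 'cV[int]_d, cone A (toR b) -> in_NA A b) ->
  (forall (x : 'cV[int]_n) j, nonneg x -> A *m x = col j A -> x = delta_mx j 0) ->
  minimal_hilbert_basis (cols A) (@cone R d n A).
Proof.
move=> nA irrA; have cinj i j : col i A = col j A -> i = j by apply: col_irr_inj.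
split; first split=> [h /mapP[j _ ->]|b /nA[x [x0 ->]]]; first exact: cone_col.
  exists (fun h => absz (\sum_(j | col j A == h) x j 0)).
  rewrite mulmx_sum_cols sum_cols; apply: eq_bigr => j _.
  rewrite (big_pred1 j) => [|i]; last by apply/eqP/eqP => [/cinj|->].
  by rewrite -scaler_nat natz gez0_abs.
move=> H [_ gen] sub h /mapP[j _ ->].
have [k e] := gen (col j A) (cone_col R A j).
have [x [x0 Ax xH]] : exists x : 'cV[int]_n, [/\ nonneg x,
    A *m x = \sum_(h <- H) h *+ k h & forall i, x i 0 != 0 -> col i A \in H].
  elim: H sub {gen e} => [|h' H IH] sub.
    exists 0; split=> [i||i]; rewrite ?mulmx0 ?big_nil ?mxE ?eqxx //.
  have [|x [x0 Ax xH]] := IH; first by move=> g gH; apply: sub; rewrite inE gH orbT.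
  have /mapP[i _ hE] : h' \in cols A by apply: sub; rewrite inE eqxx.
  exists ((k h')%:Z *: delta_mx i 0 + x); split.
  - by move=> l; rewrite !mxE addr_ge0 // mulr_ge0 // ler0n.
  - by rewrite mulmxDr Ax big_cons -scalemxAr -colE -hE -natz scaler_nat.
  - move=> l; rewrite !mxE andbT inE; have [->|li] := eqVneq l i.
      by rewrite -hE eqxx.
    by rewrite mulr0 add0r => /xH->; rewrite orbT.
rewrite -e in Ax; have xE := irrA _ _ x0 Ax.
by apply: xH; rewrite xE mxE !eqxx oner_eq0.
Qed.

(** Two optimal solutions differ by a kernel vector of cost 0; one of them then
dominates [u] and [w], and exchanging [u + w] for [v + v] improves it. *)
Lemma generic_of_exchange (c : 'rV[int]_n) (y : 'rV[int]_d) (u v w : 'I_n) :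
  (forall j, (y *m A) 0 j <= c 0 j) ->
  col u A + col w A = col v A + col v A -> c 0 v + c 0 v < c 0 u + c 0 w ->
  u != w ->
  (forall z : 'cV[int]_n, A *m z = 0 -> cost c z = 0 -> z != 0 ->
     (0 < z u 0) && (0 < z w 0) || (z u 0 < 0) && (z w 0 < 0)) ->
  generic A c.
Proof.
move=> yc rel lt_c uw ker b [x1 [x10 bE]].
have lower x : feasible A b x -> (y *m b) 0 0 <= cost c x.
  move=> [<- x0]; rewrite mulmxA mxE /cost mxE; apply: ler_sum => j _.
  by rewrite ler_wpM2r.
have [|x [xf xmin]] := exists_min lower; first by exists x1.
exists x; split=> // x' [x'f x'min]; apply/eqP; rewrite eq_sym -subr_eq0.
apply: contraT => z0.
have descent (x2 : 'cV[int]_n) : feasible A b x2 ->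
    (forall x3, feasible A b x3 -> cost c x2 <= cost c x3) ->
    0 < x2 u 0 -> 0 < x2 w 0 -> False.
  move=> [Ax2 x20] x2min xu xw.
  pose x3 := x2 + (delta_mx v 0 + delta_mx v 0) - (delta_mx u 0 + delta_mx w 0).
  have /x2min : feasible A b x3.
    split; first by rewrite mulmxBr !mulmxDr -!colE Ax2 rel addrK.
    move=> j; rewrite !mxE !andbT subr_ge0.
    have [ju|ju] := eqVneq j u; last have [jw|jw] := eqVneq j w.
    - by rewrite ju (negPf uw) addr0 ler_wpDr ?addr_ge0 ?ler0n // -gtz0_ge1.
    - by rewrite jw add0r ler_wpDr ?addr_ge0 ?ler0n // -gtz0_ge1.
    - by rewrite add0r !addr_ge0 ?ler0n.
  by rewrite costB !costD !cost_delta; move: lt_c; lia.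
have z_ge (a e : 'cV[int]_n) j : nonneg e -> 0 < (a - e) j 0 -> 0 < a j 0.
  by move=> e0; rewrite !mxE subr_gt0; apply: le_lt_trans (e0 j).
have [Az Cz] : A *m (x' - x) = 0 /\ cost c (x' - x) = 0.
  rewrite mulmxBr (proj1 x'f) (proj1 xf) subrr costB; split=> //.
  by apply/eqP; rewrite subr_eq0 eq_le xmin ?x'min.
case/orP: (ker _ Az Cz z0) => /andP[zu zw].
  by case: (descent x') => //; apply: z_ge (proj2 xf) _.
case: (descent x) => //; apply: z_ge (proj2 x'f) _.
  by rewrite -opprB mxE oppr_gt0.
by rewrite -opprB mxE oppr_gt0.
Qed.

End Criteria.

Section NoGomoryFamily.
Variables (R : realType) (d n : nat) (A : 'M[int]_(d, n)).
Local Notation toR := (map_mx (intr : int -> R)).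
Local Notation AR := (toR A).
Hypothesis rkA : \rank AR = d.
Hypothesis dn : n = d.+2.
Variables (u v w p : 'I_n) (Q : {set 'I_n}).
Hypothesis rel_uw : col u A + col w A = col v A + col v A.
Hypothesis rel_vwp : col v A + col w A + col p A = col u A + \sum_(q in Q) col q A.
Hypothesis uv : u != v.
Hypotheses (wS : w \notin [set u; v] :|: Q) (pS : p \notin [set u; v] :|: Q).
Hypothesis QS : [disjoint Q & [set u; v]].
Hypothesis wp_only : forall x : 'cV[int]_n, nonneg x ->
  A *m x = col w A + col p A -> x = delta_mx w 0 + delta_mx p 0.

(** The program of [w + p] has a single solution.  Every cell contains [u] or
[v].  At a cell with [v] the group solution [u + Q - v] is cheaper, and at a
cell with [u] the group solution [2v - u + p] is; both comparisons hold for every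
cost vector for which [u], [v] and [Q] span a cell. *)
Lemma no_gomory_family c : generic A c ->
  faces R A c ([set u; v] :|: Q) -> ~ gomory_family R A c.
Proof.
move=> cgen; have cind s : faces R A c s -> indep R A s by apply: generic_indep.
move=> [y [y_eq y_lt]] gom.
pose val (z : 'rV[R]_d) j := (z *m toR (col j A)) 0 0.
have val_uw z : val z u + val z w = val z v + val z v.
  by rewrite /val -!mulmxDrE -!map_mxD rel_uw.
have val_vwp z : val z v + val z w + val z p = val z u + \sum_(q in Q) val z q.
  rewrite /val -!mulmxDrE -!map_mxD rel_vwp map_mxD mulmxDrE; congr (_ + _).
  rewrite (_ : toR _ = \sum_(q in Q) toR (col q A)) ?mulmx_sumr ?summxE //.
  by apply/matrixP => i k; rewrite !mxE !summxE rmorph_sum; apply: eq_bigr => q _; rewrite !mxE.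
pose cR j : R := (c 0 j)%:~R.
have yu : val y u = cR u by apply: y_eq; rewrite !inE eqxx.
have yv : val y v = cR v by apply: y_eq; rewrite !inE eqxx orbT.
have yQ : \sum_(q in Q) val y q = \sum_(q in Q) cR q.
  by apply: eq_bigr => q qQ; apply: y_eq; rewrite inE qQ orbT.
have yw : val y w < cR w by apply: y_lt.
have yp : val y p < cR p by apply: y_lt.
have lt1 : cR v + cR v < cR u + cR w by have := val_uw y; lra.
have lt2 : cR u + \sum_(q in Q) cR q < cR v + cR w + cR p.
  by have := val_vwp y; lra.
have max_uv s : maximal_face (faces R A c) s -> (u \in s) || (v \in s).
  move=> sm; apply: contraT; rewrite negb_or => /andP[us vs].
  have sE : s = ~: [set u; v].
    apply/eqP; rewrite eqEcard; apply/andP; split.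
      apply/fintype.subsetP => j js; rewrite !inE negb_or.
      by apply/andP; split; apply: contraTneq js => ->.
    rewrite cardsCs finset.setCK card_ord cards2 uv (proj1 (mf_basis rkA cind sm)).
    by rewrite dn subSS subSS subn0.
  have [dy ty] := vertex_dual rkA cind sm; set z := vertex R A c s in dy ty.
  have z_eq j : j \in s -> val z j = cR j.
    by move=> js; rewrite /val dot_colE (vertex_eq rkA cind sm).
  have zu : val z u < cR u by rewrite /val dot_colE (vertex_lt rkA cind sm).
  have zw : val z w = cR w.
    by apply: z_eq; rewrite sE inE; apply: contra wS; rewrite [in X in _ -> X]inE => ->.
  have zp : val z p = cR p.
    by apply: z_eq; rewrite sE inE; apply: contra pS; rewrite [in X in _ -> X]inE => ->.
  have zQ : \sum_(q in Q) val z q = \sum_(q in Q) cR q.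
    apply: eq_bigr => q qQ; apply: z_eq; rewrite sE inE.
    by rewrite (disjointFr QS qQ).
  by have := val_uw z; have := val_vwp z; rewrite zw zp zQ; lra.
have bNA : in_NA A (col w A + col p A).
  exists (delta_mx w 0 + delta_mx p 0); split; last by rewrite mulmxDr -!colE.
  by move=> j; rewrite mxE addr_ge0 //; apply: nonneg_delta.
have [s [sm /(group_solvesE rkA cind _ sm)[x [[xo _] x0]]]] := gom _ bNA.
have xE : x = delta_mx w 0 + delta_mx p 0 by apply: wp_only => //; case: xo => -[].
have [_ xmin] := xo; rewrite xE costD !cost_delta in xmin.
case/orP: (max_uv s sm) => [us|vs].
  pose x' : 'cV[int]_n := delta_mx v 0 + delta_mx v 0 + delta_mx p 0 - delta_mx u 0.
  have /xmin : gfeas A s (col w A + col p A) x'.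
    split; first by rewrite mulmxBr !mulmxDr -!colE -rel_uw -[X in X - _ = _]addrA [LHS]addrC addKr.
    move=> j js; rewrite !mxE !andbT.
    have -> : (j == u) = false by apply: contraNF js => /eqP->.
    by rewrite subr0 !addr_ge0 ?ler0n.
  rewrite costB !costD !cost_delta -(ler_int R) !rmorphB !rmorphD /= -!/(cR _).
  by move: lt1; lra.
pose x' : 'cV[int]_n := delta_mx u 0 + \sum_(q in Q) delta_mx q 0 - delta_mx v 0.
have /xmin : gfeas A s (col w A + col p A) x'.
  split.
    rewrite mulmxBr mulmxDr -!colE mulmx_sumr (eq_bigr (fun q => col q A)).
      by rewrite -rel_vwp -[X in X - _ = _]addrA [LHS]addrC addKr.
    by move=> q _; rewrite -colE.
  move=> j js; rewrite !mxE !andbT summxE.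
  have -> : (j == v) = false by apply: contraNF js => /eqP->.
  rewrite subr0 addr_ge0 ?ler0n // sumr_ge0 // => q _; exact: nonneg_delta.
have -> : cost c x' = c 0 u + \sum_(q in Q) c 0 q - c 0 v.
  rewrite costB costD !cost_delta; congr (_ + _ - _).
  rewrite /cost mulmx_sumr summxE; apply: eq_bigr => q _.
  exact: cost_delta.
rewrite -(ler_int R) !rmorphB !rmorphD rmorph_sum /=; move: lt2; rewrite /cR.
by lra.
Qed.

End NoGomoryFamily.

(** * Two matrices that meet the criterion *)

Section Examples.
Variable R : realType.
Local Notation toR := (map_mx (intr : int -> R)).
Local Notation o3 k := (@Ordinal 3 k isT).
Local Notation o4 k := (@Ordinal 4 k isT).
Local Notation o5 k := (@Ordinal 5 k isT).
Local Notation o6 k := (@Ordinal 6 k isT).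

Lemma forall_ord3 (P : 'I_3 -> Prop) : P (o3 0) -> P (o3 1) -> P (o3 2) -> forall i, P i.
Proof. by move=> ? ? ? [[|[|[|m]]] lt] //; rewrite (bool_irrelevance lt isT). Qed.

Lemma forall_ord4 (P : 'I_4 -> Prop) :
  P (o4 0) -> P (o4 1) -> P (o4 2) -> P (o4 3) -> forall i, P i.
Proof. by move=> ? ? ? ? [[|[|[|[|m]]]] lt] //; rewrite (bool_irrelevance lt isT). Qed.

Lemma forall_ord5 (P : 'I_5 -> Prop) :
  P (o5 0) -> P (o5 1) -> P (o5 2) -> P (o5 3) -> P (o5 4) -> forall i, P i.
Proof.
by move=> ? ? ? ? ? [[|[|[|[|[|m]]]]] lt] //; rewrite (bool_irrelevance lt isT).
Qed.

Lemma forall_ord6 (P : 'I_6 -> Prop) :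
  P (o6 0) -> P (o6 1) -> P (o6 2) -> P (o6 3) -> P (o6 4) -> P (o6 5) -> forall i, P i.
Proof.
by move=> ? ? ? ? ? ? [[|[|[|[|[|[|m]]]]]] lt] //; rewrite (bool_irrelevance lt isT).
Qed.

Lemma sum_ord3 (V : nmodType) (F : 'I_3 -> V) :
  \sum_i F i = F (o3 0) + F (o3 1) + F (o3 2).
Proof.
rewrite !big_ord_recl big_ord0 addr0 !addrA.
by congr (F _ + F _ + F _); apply: val_inj.
Qed.

Lemma sum_ord4 (V : nmodType) (F : 'I_4 -> V) :
  \sum_i F i = F (o4 0) + F (o4 1) + F (o4 2) + F (o4 3).
Proof.
rewrite !big_ord_recl big_ord0 addr0 !addrA.
by congr (F _ + F _ + F _ + F _); apply: val_inj.
Qed.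

Lemma sum_ord5 (V : nmodType) (F : 'I_5 -> V) :
  \sum_i F i = F (o5 0) + F (o5 1) + F (o5 2) + F (o5 3) + F (o5 4).
Proof.
rewrite !big_ord_recl big_ord0 addr0 !addrA.
by congr (F _ + F _ + F _ + F _ + F _); apply: val_inj.
Qed.

Lemma sum_ord6 (V : nmodType) (F : 'I_6 -> V) :
  \sum_i F i = F (o6 0) + F (o6 1) + F (o6 2) + F (o6 3) + F (o6 4) + F (o6 5).
Proof.
rewrite !big_ord_recl big_ord0 addr0 !addrA.
by congr (F _ + F _ + F _ + F _ + F _ + F _); apply: val_inj.
Qed.

Definition table (d n : nat) (t : seq (seq int)) : 'M[int]_(d, n) :=
  \matrix_(i, j) nth 0 (nth [::] t i) j.

(** The columns, in this order [u], [v], [w], [p], [q], satisfy [u + w = 2v] and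
[v + w + p = u + q].  The second relation is not balanced, so [A3] is not graded. *)
Definition A3 : 'M[int]_(3, 5) := table 3 5
  [:: [:: 2; 1; 0; 0; -1]; [:: -1; 0; 1; 0; 2]; [:: 0; 0; 0; 1; 1]].

(** As [A3], with a further unit vector [q'] and [v + w + p = u + q + q']; both
relations are balanced now. *)
Definition A4 : 'M[int]_(4, 6) := table 4 6
  [:: [:: 2; 1; 0; 0; -1; 0]; [:: -1; 0; 1; 0; 2; 0];
      [:: 0; 0; 0; 1; 1; 0]; [:: 0; 0; 0; 0; -1; 1]].

Lemma A3Z (x : 'cV[int]_5) :
  [/\ (A3 *m x) (o3 0) 0 = 2 * x (o5 0) 0 + x (o5 1) 0 - x (o5 4) 0,
      (A3 *m x) (o3 1) 0 = - x (o5 0) 0 + x (o5 2) 0 + 2 * x (o5 4) 0 &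
      (A3 *m x) (o3 2) 0 = x (o5 3) 0 + x (o5 4) 0].
Proof. by split; rewrite mxE sum_ord5 !mxE /=; ring. Qed.

Lemma A3R (x : 'cV[R]_5) :
  [/\ (toR A3 *m x) (o3 0) 0 = 2 * x (o5 0) 0 + x (o5 1) 0 - x (o5 4) 0,
      (toR A3 *m x) (o3 1) 0 = - x (o5 0) 0 + x (o5 2) 0 + 2 * x (o5 4) 0 &
      (toR A3 *m x) (o3 2) 0 = x (o5 3) 0 + x (o5 4) 0].
Proof. by split; rewrite mxE sum_ord5 !mxE /=; ring. Qed.

Lemma A4Z (x : 'cV[int]_6) :
  [/\ (A4 *m x) (o4 0) 0 = 2 * x (o6 0) 0 + x (o6 1) 0 - x (o6 4) 0,
      (A4 *m x) (o4 1) 0 = - x (o6 0) 0 + x (o6 2) 0 + 2 * x (o6 4) 0,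
      (A4 *m x) (o4 2) 0 = x (o6 3) 0 + x (o6 4) 0 &
      (A4 *m x) (o4 3) 0 = x (o6 5) 0 - x (o6 4) 0].
Proof. by split; rewrite mxE sum_ord6 !mxE /=; ring. Qed.

Lemma A4R (x : 'cV[R]_6) :
  [/\ (toR A4 *m x) (o4 0) 0 = 2 * x (o6 0) 0 + x (o6 1) 0 - x (o6 4) 0,
      (toR A4 *m x) (o4 1) 0 = - x (o6 0) 0 + x (o6 2) 0 + 2 * x (o6 4) 0,
      (toR A4 *m x) (o4 2) 0 = x (o6 3) 0 + x (o6 4) 0 &
      (toR A4 *m x) (o4 3) 0 = x (o6 5) 0 - x (o6 4) 0].
Proof. by split; rewrite mxE sum_ord6 !mxE /=; ring. Qed.

Lemma A3_rank : \rank (toR A3) = 3%N.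
Proof.
apply/eqP; rewrite -/(row_free _); apply/row_freeP.
exists (\matrix_(i, j) ((i == j.+1 :> nat)%:R)).
apply/matrixP; apply: forall_ord3; apply: forall_ord3;
  by rewrite mxE sum_ord5 !mxE /=; ring.
Qed.

Lemma A4_rank : \rank (toR A4) = 4%N.
Proof.
apply/eqP; rewrite -/(row_free _); apply/row_freeP.
exists (\matrix_(i, j) ((i == (if j == 3 :> nat then 5 else j.+1) :> nat)%:R)).
apply/matrixP; apply: forall_ord4; apply: forall_ord4;
  by rewrite mxE sum_ord6 !mxE /=; ring.
Qed.

Lemma A3_pos (u : 'cV[R]_5) : nonneg u -> toR A3 *m u = 0 -> u = 0.
Proof.
move=> u0 e; have [] := A3R u; rewrite e !mxE => e0 e1 e2.
have u0' := (u0 (o5 0), u0 (o5 1), u0 (o5 2), u0 (o5 3), u0 (o5 4)).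
case: u0' => -[[[g0 g1] g2] g3] g4.
by apply/matrixP; apply: forall_ord5 => i; rewrite ord1 mxE; lra.
Qed.

Lemma A4_pos (u : 'cV[R]_6) : nonneg u -> toR A4 *m u = 0 -> u = 0.
Proof.
move=> u0 e; have [] := A4R u; rewrite e !mxE => e0 e1 e2 e3.
have u0' := (u0 (o6 0), u0 (o6 1), u0 (o6 2), u0 (o6 3), u0 (o6 4), u0 (o6 5)).
case: u0' => -[[[[g0 g1] g2] g3] g4] g5.
by apply/matrixP; apply: forall_ord6 => i; rewrite ord1 mxE; lra.
Qed.


Lemma nonneg5 (x : 'cV[int]_5) : nonneg x ->
  [/\ 0 <= x (o5 0) 0, 0 <= x (o5 1) 0, 0 <= x (o5 2) 0, 0 <= x (o5 3) 0 &
      0 <= x (o5 4) 0].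
Proof. by move=> x0; split; apply: x0. Qed.

Lemma nonneg6 (x : 'cV[int]_6) : nonneg x ->
  [/\ 0 <= x (o6 0) 0, 0 <= x (o6 1) 0 & 0 <= x (o6 2) 0] /\
  [/\ 0 <= x (o6 3) 0, 0 <= x (o6 4) 0 & 0 <= x (o6 5) 0].
Proof. by move=> x0; do 2!split; apply: x0. Qed.

Lemma A3_irr (x : 'cV[int]_5) j : nonneg x -> A3 *m x = col j A3 -> x = delta_mx j 0.
Proof.
move=> /nonneg5[g0 g1 g2 g3 g4]; have [] := A3Z x; move: j.
apply: forall_ord5 => e0 e1 e2 e; rewrite e !mxE /= in e0 e1 e2;
  apply/matrixP; apply: forall_ord5 => i; rewrite ord1 mxE -!val_eqE /=; lia.
Qed.

Lemma A4_irr (x : 'cV[int]_6) j : nonneg x -> A4 *m x = col j A4 -> x = delta_mx j 0.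
Proof.
move=> /nonneg6[[g0 g1 g2] [g3 g4 g5]]; have [] := A4Z x; move: j.
apply: forall_ord6 => e0 e1 e2 e3 e; rewrite e !mxE /= in e0 e1 e2 e3;
  apply/matrixP; apply: forall_ord6 => i; rewrite ord1 mxE -!val_eqE /=; lia.
Qed.

Lemma A3_wp (x : 'cV[int]_5) : nonneg x -> A3 *m x = col (o5 2) A3 + col (o5 3) A3 ->
  x = delta_mx (o5 2) 0 + delta_mx (o5 3) 0.
Proof.
move=> /nonneg5[g0 g1 g2 g3 g4] e; have [] := A3Z x; rewrite e !mxE /= => e0 e1 e2.
by apply/matrixP; apply: forall_ord5 => i; rewrite ord1 !mxE -!val_eqE /=; lia.
Qed.

Lemma A4_wp (x : 'cV[int]_6) : nonneg x -> A4 *m x = col (o6 2) A4 + col (o6 3) A4 ->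
  x = delta_mx (o6 2) 0 + delta_mx (o6 3) 0.
Proof.
move=> /nonneg6[[g0 g1 g2] [g3 g4 g5]] e; have [] := A4Z x; rewrite e !mxE /= => e0 e1 e2 e3.
by apply/matrixP; apply: forall_ord6 => i; rewrite ord1 !mxE -!val_eqE /=; lia.
Qed.

(** The four inequalities are the facets of the cone.  Given a lattice point, the
coefficient [k] of [q] is the least one that makes the first coordinate
representable, and then [m] is the least coefficient of [u] that makes the second
one so. *)
Lemma A3_normal (b : 'cV[int]_3) : cone A3 (toR b) -> in_NA A3 b.
Proof.
move=> [u [u0 bE]]; have [[[[g0 g1] g2] g3] g4] :=
  (u0 (o5 0), u0 (o5 1), u0 (o5 2), u0 (o5 3), u0 (o5 4)).
have [] := A3R u; rewrite -bE !mxE.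
have [b0 E0] : exists k, b (o3 0) 0 = k by eexists.
have [b1 E1] : exists k, b (o3 1) 0 = k by eexists.
have [b2 E2] : exists k, b (o3 2) 0 = k by eexists.
rewrite E0 E1 E2 => e0 e1 e2.
have f1 : 0 <= b2 by rewrite -(ler0z R); lra.
have f2 : 0 <= b0 + b2 by rewrite -(ler0z R) intrD; lra.
have f3 : 0 <= 2 * b0 + b1 by rewrite -(ler0z R) intrD intrM; lra.
have f4 : 0 <= b0 + 2 * b1 by rewrite -(ler0z R) intrD intrM; lra.
pose k := Num.max 0 (- b0); pose m := Num.max 0 (2 * k - b1).
exists (\col_i nth 0 [:: m; b0 - 2 * m + k; b1 + m - 2 * k; b2 - k; k] i); split.
  by apply: forall_ord5; rewrite mxE /= /m /k; lia.
apply/matrixP => i j; rewrite ord1; move: i {j}.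
have [r0 r1 r2] := A3Z (\col_i nth 0 [:: m; b0 - 2 * m + k; b1 + m - 2 * k; b2 - k; k] i).
by apply: forall_ord3; rewrite ?r0 ?r1 ?r2 ?E0 ?E1 ?E2 !mxE /=; lia.
Qed.

(** As for [A3]; the last coordinate gives one more lower bound on the coefficient
[k] of [q]. *)
Lemma A4_normal (b : 'cV[int]_4) : cone A4 (toR b) -> in_NA A4 b.
Proof.
move=> [u [u0 bE]]; have [[[[[g0 g1] g2] g3] g4] g5] :=
  (u0 (o6 0), u0 (o6 1), u0 (o6 2), u0 (o6 3), u0 (o6 4), u0 (o6 5)).
have [] := A4R u; rewrite -bE !mxE.
have [b0 E0] : exists k, b (o4 0) 0 = k by eexists.
have [b1 E1] : exists k, b (o4 1) 0 = k by eexists.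
have [b2 E2] : exists k, b (o4 2) 0 = k by eexists.
have [b3 E3] : exists k, b (o4 3) 0 = k by eexists.
rewrite E0 E1 E2 E3 => e0 e1 e2 e3.
have f1 : 0 <= b2 by rewrite -(ler0z R); lra.
have f2 : 0 <= b0 + b2 by rewrite -(ler0z R) intrD; lra.
have f3 : 0 <= 2 * b0 + b1 by rewrite -(ler0z R) intrD intrM; lra.
have f4 : 0 <= b0 + 2 * b1 by rewrite -(ler0z R) intrD intrM; lra.
have f5 : 0 <= b2 + b3 by rewrite -(ler0z R) intrD; lra.
have f6 : 0 <= b0 + 2 * b1 + 3 * b3 by rewrite -(ler0z R) !intrD !intrM; lra.
pose k := Num.max 0 (Num.max (- b0) (- b3)); pose m := Num.max 0 (2 * k - b1).
pose x : 'cV[int]_6 :=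
  \col_i nth 0 [:: m; b0 - 2 * m + k; b1 + m - 2 * k; b2 - k; k; b3 + k] i.
exists x; split.
  by apply: forall_ord6; rewrite mxE /= /m /k; lia.
apply/matrixP => i j; rewrite ord1; move: i {j}.
have [r0 r1 r2 r3] := A4Z x.
by apply: forall_ord4; rewrite ?r0 ?r1 ?r2 ?r3 ?E0 ?E1 ?E2 ?E3 !mxE /=; lia.
Qed.

(** This puts [v] below the segment from [u] to [w], and [q] low enough for
[u], [v], [q] to span a cell. *)
Definition A3_cost : 'rV[int]_5 := \row_j nth 0 [:: 1; 0; 0; 0; -3] j.
Definition A4_cost : 'rV[int]_6 := \row_j nth 0 [:: 1; 0; 0; 0; -3; 0] j.

Lemma A3_rel_uw : col (o5 0) A3 + col (o5 2) A3 = col (o5 1) A3 + col (o5 1) A3.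
Proof. by apply/matrixP => i j; move: i; apply: forall_ord3; rewrite !mxE. Qed.

Lemma A4_rel_uw : col (o6 0) A4 + col (o6 2) A4 = col (o6 1) A4 + col (o6 1) A4.
Proof. by apply/matrixP => i j; move: i; apply: forall_ord4; rewrite !mxE. Qed.

Lemma A3_rel_vwp : col (o5 1) A3 + col (o5 2) A3 + col (o5 3) A3 =
  col (o5 0) A3 + \sum_(q in [set o5 4]) col q A3.
Proof.
rewrite big_set1.
by apply/matrixP => i j; move: i; apply: forall_ord3; rewrite !mxE.
Qed.

Lemma A4_rel_vwp : col (o6 1) A4 + col (o6 2) A4 + col (o6 3) A4 =
  col (o6 0) A4 + \sum_(q in [set o6 4; o6 5]) col q A4.
Proof.
rewrite big_setU1 ?big_set1; last by rewrite !inE.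
by apply/matrixP => i j; move: i; apply: forall_ord4; rewrite !mxE.
Qed.

(** A kernel vector of cost 0 is a multiple of [3u - 5v + w - p + q], whose entries at
[u] and [w] have the same sign. *)
Lemma A3_cost_generic : generic A3 A3_cost.
Proof.
apply: (@generic_of_exchange _ _ _ _ (const_mx (-2)) (o5 0) (o5 1) (o5 2)) => //.
- by apply: forall_ord5; rewrite mxE sum_ord3 !mxE.
- exact: A3_rel_uw.
- by rewrite !mxE.
move=> z e; have [r0 r1 r2] := A3Z z.
have e0 : 2 * z (o5 0) 0 + z (o5 1) 0 - z (o5 4) 0 = 0 by rewrite -r0 e mxE.
have e1 : - z (o5 0) 0 + z (o5 2) 0 + 2 * z (o5 4) 0 = 0 by rewrite -r1 e mxE.
have e2 : z (o5 3) 0 + z (o5 4) 0 = 0 by rewrite -r2 e mxE.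
rewrite /cost mxE sum_ord5 !mxE /= => ec z0.
have {}ec : z (o5 0) 0 = 3 * z (o5 4) 0 by apply/eqP; rewrite -subr_eq0 -ec; apply/eqP; ring.
have z4 : z (o5 4) 0 <> 0.
  move=> z4; case/negP: z0; apply/eqP.
  have zk : forall k, z k 0 = 0 by apply: forall_ord5; lia.
  by apply/matrixP => i j; rewrite ord1 zk mxE.
by lia.
Qed.

(** A kernel vector of cost 0 is a multiple of [3u - 5v + w - p + q + q']. *)
Lemma A4_cost_generic : generic A4 A4_cost.
Proof.
apply: (@generic_of_exchange _ _ _ _ (const_mx (-3)) (o6 0) (o6 1) (o6 2)) => //.
- by apply: forall_ord6; rewrite mxE sum_ord4 !mxE.
- exact: A4_rel_uw.
- by rewrite !mxE.
move=> z e; have [r0 r1 r2 r3] := A4Z z.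
have e0 : 2 * z (o6 0) 0 + z (o6 1) 0 - z (o6 4) 0 = 0 by rewrite -r0 e mxE.
have e1 : - z (o6 0) 0 + z (o6 2) 0 + 2 * z (o6 4) 0 = 0 by rewrite -r1 e mxE.
have e2 : z (o6 3) 0 + z (o6 4) 0 = 0 by rewrite -r2 e mxE.
have e3 : z (o6 5) 0 - z (o6 4) 0 = 0 by rewrite -r3 e mxE.
rewrite /cost mxE sum_ord6 !mxE /= => ec z0.
have {}ec : z (o6 0) 0 = 3 * z (o6 4) 0 by apply/eqP; rewrite -subr_eq0 -ec; apply/eqP; ring.
have z4 : z (o6 4) 0 <> 0.
  move=> z4; case/negP: z0; apply/eqP.
  have zk : forall k, z k 0 = 0 by apply: forall_ord6; lia.
  by apply/matrixP => i j; rewrite ord1 zk mxE.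
by lia.
Qed.

Lemma A3_cost_face : faces R A3 A3_cost ([set o5 0; o5 1] :|: [set o5 4]).
Proof.
exists (\row_i nth 0 [:: 0; -1; -1] i); split;
  apply: forall_ord5; rewrite !inE -!val_eqE /= => // _;
  rewrite mxE sum_ord3 !mxE /=; lra.
Qed.

Lemma A4_cost_face : faces R A4 A4_cost ([set o6 0; o6 1] :|: [set o6 4; o6 5]).
Proof.
exists (\row_i nth 0 [:: 0; -1; -1; 0] i); split;
  apply: forall_ord6; rewrite !inE -!val_eqE /= => // _;
  rewrite mxE sum_ord4 !mxE /=; lra.
Qed.

Lemma A3_none c : generic A3 c -> faces R A3 c ([set o5 0; o5 1] :|: [set o5 4]) ->
  ~ gomory_family R A3 c.
Proof.
apply: (no_gomory_family A3_rank _ A3_rel_uw A3_rel_vwp _ _ _ _ A3_wp) => //.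
- by rewrite !inE.
- by rewrite !inE.
- by rewrite disjoints1 !inE.
Qed.

Lemma A4_none c : generic A4 c ->
  faces R A4 c ([set o6 0; o6 1] :|: [set o6 4; o6 5]) -> ~ gomory_family R A4 c.
Proof.
apply: (no_gomory_family A4_rank _ A4_rel_uw A4_rel_vwp _ _ _ _ A4_wp) => //.
- by rewrite !inE.
- by rewrite !inE.
- by rewrite disjoint_subset; apply/fintype.subsetP => j; rewrite !inE => /orP[]/eqP->.
Qed.

Lemma A3_not_graded : ~ graded R A3.
Proof.
move=> [w [be [w0 aff]]].
have val j : (w *m toR (col j A3)) 0 0 = be.
  apply/aff; exists (delta_mx j 0); split; last exact: map_colE.
  rewrite (bigD1 j) //= big1 ?addr0 => [|k kj]; rewrite mxE ?eqxx //.
  by rewrite (negPf kj).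
have v0 := val (o5 0); have v1 := val (o5 1); have v2 := val (o5 2).
have v3 := val (o5 3); have v4 := val (o5 4).
rewrite mxE sum_ord3 !mxE /= in v0; rewrite mxE sum_ord3 !mxE /= in v1.
rewrite mxE sum_ord3 !mxE /= in v2; rewrite mxE sum_ord3 !mxE /= in v3.
rewrite mxE sum_ord3 !mxE /= in v4.
case/negP: w0; apply/eqP/matrixP => i; rewrite ord1; apply: forall_ord3;
  rewrite mxE; lra.
Qed.

Lemma A4_graded : graded R A4.
Proof.
exists (const_mx 1), 1; split.
  by apply/eqP => /matrixP/(_ 0 (o4 0)); rewrite !mxE => /eqP; rewrite oner_eq0.
move=> v; split=> [[l [l1 ->]]|].
  have [r0 r1 r2 r3] := A4R l.
  rewrite mxE sum_ord4 r0 r1 r2 r3 !mxE; move: l1; rewrite sum_ord6; lra.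
rewrite mxE sum_ord4 !mxE => v1.
pose l : 'cV[R]_6 := \col_i nth 0
  [:: 0; v (o4 0) 0; v (o4 1) 0; v (o4 2) 0; 0; v (o4 3) 0] i.
exists l; split; first by rewrite sum_ord6 !mxE /=; lra.
have [r0 r1 r2 r3] := A4R l.
apply/matrixP => i j; rewrite ord1; move: i.
by apply: forall_ord4; rewrite ?r0 ?r1 ?r2 ?r3 !mxE /=; lra.
Qed.

End Examples.

(** * The theorem *)

Section LowDimensionalTriangulations.
Variables (R : realType) (d n : nat) (A : 'M[int]_(d, n)).
Local Notation toR := (map_mx (intr : int -> R)).
Local Notation AR := (toR A).

(** A hyperplane through 0 cannot contain all columns, by the rank condition, so the
functional can be normalised. *)
Lemma graded_height : \rank AR = d -> graded R A ->
  exists h : 'rV[R]_d, forall j, (h *m AR) 0 j = 1.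
Proof.
move=> rkA [w [be [w0 aff]]].
have val j : (w *m AR) 0 j = be.
  rewrite -dot_colE; apply/aff; exists (delta_mx j 0); split; last exact: map_colE.
  rewrite (bigD1 j) //= big1 ?addr0 => [|k kj]; rewrite mxE ?eqxx //.
  by rewrite (negPf kj).
have be0 : be != 0.
  apply: contra w0 => /eqP be0; have rf : row_free AR by rewrite /row_free rkA.
  rewrite -(mulmx_free_eq0 _ rf); apply/eqP/matrixP => i j.
  by rewrite ord1 val be0 mxE.
by exists (be^-1 *: w) => j; rewrite mulmx_linE val mulVf.
Qed.

Lemma low_dimension_cell_normal :
  admissible R A -> normal R A -> d = 1%N \/ d = 2%N \/ (graded R A /\ d = 3%N) ->
  forall s, basis R A s -> cell_normal R A s.
Proof.
move=> [rkA _ posA colsU hbA] nA dA.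
have normalA b : cone A (toR b) -> in_NA A b by move=> /nA.
have irrA x j : nonneg x -> A *m x = col j A -> x = delta_mx j 0.
  exact: irreducible_col posA colsU x j hbA.
apply: (cell_normal_of_parallelepiped posA normalA irrA) => s b sb b0 bp.
case: dA => [d1|[d2|[gA d3]]].
- by have := parallelepiped1 normalA irrA d1 sb bp => /eqP; rewrite (negPf b0).
- exact: (parallelepiped2 posA normalA irrA d2 sb b0 bp).
- have [h hA] := graded_height rkA gA.
  exact: (parallelepiped3 normalA hA d3 sb b0 bp).
Qed.

Lemma low_dimension_supports :
  admissible R A -> normal R A -> d = 1%N \/ d = 2%N \/ (graded R A /\ d = 3%N) ->
  forall Delta, regular_triangulation R A Delta -> exists c, supports R A Delta c.
Proof.
move=> adA nA dA Delta [c [cgen ->]].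
have [rkA _ posA _ _] := adA.
have cind s : faces R A c s -> indep R A s by apply: generic_indep.
apply: (supports_of_cell_normal rkA posA cind) => s sm.
by apply: low_dimension_cell_normal => //; apply: (mf_basis rkA cind sm).
Qed.

Lemma planar_graded_unique :
  admissible R A -> normal R A -> d = 2%N -> graded R A ->
  forall Delta c c', supports R A Delta c -> supports R A Delta c' ->
  opt_solutions A c = opt_solutions A c'.
Proof.
move=> [rkA _ posA colsU hbA] nA d2 gA Delta c c'.
have normalA b : cone A (toR b) -> in_NA A b by move=> /nA.
have irrA x j : nonneg x -> A *m x = col j A -> x = delta_mx j 0.
  exact: irreducible_col posA colsU x j hbA.
have [h hA] := graded_height rkA gA.
exact: (supports_opt_solutions rkA posA normalA irrA d2 hA).
Qed.

Lemma admissible_normal :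
  \rank AR = d ->
  (forall u : 'cV[R]_n, nonneg u -> AR *m u = 0 -> u = 0) ->
  (forall b : 'cV[int]_d, cone A (toR b) -> in_NA A b) ->
  (forall (x : 'cV[int]_n) j, nonneg x -> A *m x = col j A -> x = delta_mx j 0) ->
  admissible R A /\ normal R A.
Proof.
move=> rkA posA normalA irrA; split; last by move=> b; split=> [/(cone_NA R)|/normalA].
split=> //; [exact: pointed_cone | | exact: minimal_hilbert_basis_cols].
by apply/injectiveP; move=> i j; apply: col_irr_inj.
Qed.

(** The failure of Delta-normality follows from [supports_of_cell_normal]. *)
Lemma supports_none c s :
  \rank AR = d -> (forall u : 'cV[R]_n, nonneg u -> AR *m u = 0 -> u = 0) ->
  generic A c -> faces R A c s ->
  (forall c', generic A c' -> faces R A c' s -> ~ gomory_family R A c') ->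
  (exists Delta, regular_triangulation R A Delta /\
     ~ (exists c', supports R A Delta c')) /\
  ~ (forall Delta, regular_triangulation R A Delta -> Delta_normal R A Delta).
Proof.
move=> rkA posA cgen cs none.
have nosup : ~ (exists c', supports R A (faces R A c) c').
  by move=> [c' [c'gen fE]]; apply: none => //; rewrite -fE.
have reg : regular_triangulation R A (faces R A c) by exists c.
split; first by exists (faces R A c).
move=> /(_ _ reg) Dn; apply: nosup.
have cind t : faces R A c t -> indep R A t by apply: generic_indep.
apply: (supports_of_cell_normal rkA posA cind) => t tm.
exact: Delta_normal_cell_normal cind Dn tm.
Qed.

End LowDimensionalTriangulations.

Theorem theorem7p14 (R : realType) :
  (* (i) *)
  (forall (d n : nat) (A : 'M[int]_(d, n)),
     admissible R A -> normal R A ->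
     d = 1%N \/ d = 2%N \/ (graded R A /\ d = 3%N) ->
     forall Delta : set {set 'I_n}, regular_triangulation R A Delta ->
       exists c : 'rV[int]_n, supports R A Delta c)
  /\
  (* (ii) *)
  (forall (d n : nat) (A : 'M[int]_(d, n)),
     admissible R A -> normal R A ->
     d = 2%N -> graded R A ->
     forall Delta : set {set 'I_n}, regular_triangulation R A Delta ->
       (exists c : 'rV[int]_n, supports R A Delta c) /\
       (forall c c' : 'rV[int]_n,
          supports R A Delta c -> supports R A Delta c' ->
          opt_solutions A c = opt_solutions A c'))
  /\
  (* (iii) *)
  (exists (n : nat) (A : 'M[int]_(3, n)),
     [/\ admissible R A /\ normal R A,
         ~ graded R A,
         (exists Delta : set {set 'I_n}, regular_triangulation R A Delta /\
            ~ (exists c : 'rV[int]_n, supports R A Delta c))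
       & ~ (forall Delta : set {set 'I_n},
              regular_triangulation R A Delta -> Delta_normal R A Delta)])
  /\
  (exists (n : nat) (A : 'M[int]_(4, n)),
     [/\ admissible R A /\ normal R A,
         graded R A,
         (exists Delta : set {set 'I_n}, regular_triangulation R A Delta /\
            ~ (exists c : 'rV[int]_n, supports R A Delta c))
       & ~ (forall Delta : set {set 'I_n},
              regular_triangulation R A Delta -> Delta_normal R A Delta)]).
Proof.
split; first by move=> d n A; apply: low_dimension_supports.
split.
  move=> d n A adA nA d2 gA Delta reg; split.
    by apply: low_dimension_supports => //; right; left.
  by move=> c c'; apply: planar_graded_unique.
split.
  exists 5%N, A3.
  have [] := supports_none (A3_rank R) (@A3_pos R) A3_cost_generic (A3_cost_face R) (@A3_none R).
  split=> //; last exact: A3_not_graded.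
  exact: admissible_normal (A3_rank R) (@A3_pos R) (@A3_normal R) A3_irr.
exists 6%N, A4.
have [] := supports_none (A4_rank R) (@A4_pos R) A4_cost_generic (A4_cost_face R) (@A4_none R).
split=> //; last exact: A4_graded.
exact: admissible_normal (A4_rank R) (@A4_pos R) (@A4_normal R) A4_irr.
Qed.
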